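(* For Lebesgue almost every $\omega \in (0,1)$, $$\lim_{n\to\infty}\frac{R_n(\omega)}{\sqrt{n}}=\sqrt{\frac{\pi}{\log 2}},$$ and for every integer $k\ge 1$, $$\lim_{n\to\infty}\frac{R_{n,k}(\omega)}{R_n(\omega)}=\frac{\binom{2k}{k}}{(2k-1)\cdot 4^k}=:r_k .$$ Moreover $\sum_{k=1}^\infty r_k=1$.
   Context: For irrational $\omega\in(0,1)$ write its continued fraction expansion $\omega=[a_1,a_2,\dots]=\cfrac{1}{a_1+\cfrac{1}{a_2+\cdots}}$ with partial quotients $a_i=a_i(\omega)\in\mathbb{N}$. For $x\in\mathbb{N}$ let $N_n(x,\omega)=\#\{1\le i\le n: a_i(\omega)=x\}$. Define $R_n(\omega)=\#\{x\in\mathbb{N}: N_n(x,\omega)\ge 1\}$ (the number of distinct values among $a_1(\omega),\dots,a_n(\omega)$) and, for $k\ge1$, $R_{n,k}(\omega)=\#\{x\in\mathbb{N}: N_n(x,\omega)=k\}$ (the number of distinct values appearing exactly $k$ times among $a_1(\omega),\dots,a_n(\omega)$). Here $\log$ is the natural logarithm. *)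

(* Defs.v *)
From HB Require Import structures.
From mathcomp Require Import all_boot all_order all_algebra.
From mathcomp Require Import all_classical all_reals all_analysis.
Set Implicit Arguments. Unset Strict Implicit. Unset Printing Implicit Defensive.
Import Order.TTheory GRing.Theory Num.Theory.
Import numFieldNormedType.Exports.
Local Open Scope ring_scope.

Definition gauss {R : realType} (x : R) : R := x^-1 - (Num.floor (x^-1))%:~R.

(* i-th partial quotient, 0-indexed: cf_digit w i = a_{i+1}(w) = floor(1/T^i w).
   (For irrational w in (0,1), T^i w in (0,1) and 1/T^i w > 1, so truncn = floor.) *)
Definition cf_digit {R : realType} (w : R) (i : nat) : nat :=
  Num.truncn ((iter i gauss w)^-1).

Definition cf_prefix {R : realType} (w : R) (n : nat) : seq nat :=
  [seq cf_digit w i | i <- iota 0 n].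

Definition Ncount {R : realType} (n x : nat) (w : R) : nat :=
  count_mem x (cf_prefix w n).

Definition Rn {R : realType} (n : nat) (w : R) : nat :=
  size (undup (cf_prefix w n)).

Definition Rnk {R : realType} (n k : nat) (w : R) : nat :=
  size [seq x <- undup (cf_prefix w n) | Ncount n x w == k].

Definition rk {R : realType} (k : nat) : R :=
  ('C(k.*2, k))%:R / ((k.*2 - 1)%:R * 4 ^+ k).

(* Main.v *)
(* Under Lebesgue measure the numbers s_m = [a_m, ..., a_1] form a Markov chain:
   given s_m, the next partial quotient is x with probability
   (1 + s_m) / ((x + s_m) (x + 1 + s_m)), about (1 + s_m) / x^2, and then
   s_(m+1) = 1 / (x + s_m). Its transition operator P contracts Lipschitz
   constants, and preserves the integral against the Gauss density, so
   P^m (1 + s) tends to 1 / ln 2 uniformly and exponentially fast. Perturbing P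
   by a weight z on the digits of a set of at most two large values, and using
   the solution of the Poisson equation as first-order corrector of the
   eigenfunction, one obtains, for x <> y of order sqrt n, E z^(N_n x) and
   E z^(N_n x + N_n y) up to small errors, hence asymptotic independence. By
   Chebyshev's inequality and the Borel-Cantelli lemma along n = j^32, and
   monotonicity in n, the sum over the values x seen so far
     W_n z = sum_x (1 - z^(N_n x))
   satisfies W_n z / sqrt n --> sqrt (pi (1 - z) / ln 2) almost everywhere, for
   every z in [0, 1); the constant is the integral of 1 - exp (- (s / u)^2).
   At z = 0 this is the limit of R_n / sqrt n, and dividing by R_n gives
   sum_k z^k R_{n,k} / R_n --> 1 - sqrt (1 - z) = sum_k r_k z^k
   for z = 1/2, 1/3, ..., which determines the limits of the R_{n,k} / R_n.
   All probabilities are computed on a finite alphabet, by merging the digits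
   above a bound M that grows much faster than n. *)
Require Import Defs.
From HB Require Import structures.
From mathcomp Require Import all_boot all_order all_algebra.
From mathcomp Require Import all_classical all_reals all_analysis.
From mathcomp Require Import zify ring lra.
Import Order.TTheory GRing.Theory Num.Theory.
Import numFieldNormedType.Exports.
Local Open Scope classical_set_scope.
Local Open Scope ring_scope.

(** * The Markov chain of the reversed continued fractions *)

Section digit_chain.
Context {R : realType} (M : nat).
Implicit Types (s t : R) (a : nat) (f : R -> R).

(* The law of the next partial quotient given s = [a_m, ..., a_1], with all
   values above M merged into the single letter M.+1: [ptail a s] is the
   probability of a value at least a. *)
Definition ptail a s : R := if (a <= M.+1)%N then (1 + s) / (a%:R + s) else 0.
Definition pdig a s : R := ptail a s - ptail a.+1 s.
Definition step a s : R := (a%:R + s)^-1.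
Definition trans f s : R := \sum_(1 <= a < M.+2) pdig a s * f (step a s).

Lemma ler1_nat a : (0 < a)%N -> 1 <= a%:R :> R.
Proof. by rewrite -[1]/(1%:R) ler_nat. Qed.

Lemma step_itv a s : (0 < a)%N -> 0 <= s <= 1 -> 0 <= step a s <= 1.
Proof.
move=> /ler1_nat a1 s01; rewrite /step invr_ge0 invf_le1; last by lra.
by apply/andP; split; lra.
Qed.

Lemma pdig_lt a s : (0 < a <= M)%N -> 0 <= s <= 1 ->
  pdig a s = (1 + s) / ((a%:R + s) * (a.+1%:R + s)).
Proof.
move=> /andP[/ler1_nat a1 aM] s01.
rewrite /pdig /ptail leqW// ltnS aM -natr1; field.
by apply/andP; split; apply: lt0r_neq0; lra.
Qed.

Lemma pdig_last s : pdig M.+1 s = (1 + s) / (M.+1%:R + s).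
Proof. by rewrite /pdig /ptail leqnn ltnn subr0. Qed.

Lemma pdig_ge0 a s : (0 < a)%N -> 0 <= s <= 1 -> 0 <= pdig a s.
Proof.
move=> a0 s01; have [aM|Ma] := leqP a M.
  rewrite pdig_lt ?a0//; have a1 := ler1_nat a a0.
  by rewrite -natr1 divr_ge0 ?mulr_ge0//; lra.
case: (ltngtP a M.+1) Ma => // [aM _|-> _].
  by rewrite /pdig /ptail !ifF ?subrr// leqNgt ?aM// ltnW.
by rewrite pdig_last divr_ge0 ?addr_ge0//; lra.
Qed.

Lemma ptail1 s : 0 <= s <= 1 -> ptail 1 s = 1.
Proof. by move=> s01; rewrite /ptail divff//; apply: lt0r_neq0; lra. Qed.

Lemma ptail_over s : ptail M.+2 s = 0.
Proof. by rewrite /ptail ltnn. Qed.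

Lemma sum_pdig_from m s : (m <= M.+1)%N ->
  \sum_(m <= a < M.+2) pdig a s = (1 + s) / (m%:R + s).
Proof.
move=> mM; rewrite (telescope_sumr_eq (fun a => - ptail a s)) ; first last.
- by move=> k _; rewrite /pdig; ring.
- exact: leqW.
by rewrite /ptail ltnn mM; ring.
Qed.

Lemma sum_pdig s : 0 <= s <= 1 -> \sum_(1 <= a < M.+2) pdig a s = 1.
Proof. by move=> s01; rewrite sum_pdig_from// divff//; apply: lt0r_neq0; lra. Qed.

Definition lipschitz01 (L : R) (f : R -> R) := forall u v : R, 0 <= u <= 1 -> 0 <= v <= 1 ->
  `|f u - f v| <= L * `|u - v|.

(** Abel summation. With [T] a difference of two tails both boundary terms vanish, and only
    increments of [g] between neighbouring letters remain. *)
Lemma sumr_by_parts (T g : nat -> R) N :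
  \sum_(1 <= a < N.+2) (T a - T a.+1) * g a =
  T 1%N * g 1%N - T N.+2 * g N.+1
  + \sum_(1 <= a < N.+1) T a.+1 * (g a.+1 - g a).
Proof.
elim: N => [|N IH]; first by rewrite big_nat1 big_geq//; ring.
by rewrite big_nat_recr//= IH [in RHS]big_nat_recr//=; ring.
Qed.

(** The derivative of (1 + s) / (a + 1 + s) is a / (a + 1 + s)^2, which is largest at s = 0. *)
Lemma ptailB a s t : (0 < a <= M)%N -> 0 <= s <= 1 -> 0 <= t <= 1 ->
  `|ptail a.+1 s - ptail a.+1 t| <= a%:R / (a%:R + 1) ^+ 2 * `|s - t|.
Proof.
move=> /andP[/ler1_nat a1 aM] s01 t01; rewrite /ptail ltnS aM -natr1.
have -> : (1 + s) / (a%:R + 1 + s) - (1 + t) / (a%:R + 1 + t) =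
    a%:R / ((a%:R + 1 + s) * (a%:R + 1 + t)) * (s - t).
  by field; apply/andP; split; apply: lt0r_neq0; lra.
rewrite normrM ler_wpM2r// ger0_norm; last first.
  by rewrite divr_ge0// mulr_ge0//; lra.
by rewrite ler_wpM2l// lef_pV2 ?posrE; nra.
Qed.

Lemma stepB a t : (0 < a)%N -> 0 <= t <= 1 ->
  `|step a.+1 t - step a t| <= (a%:R * (a%:R + 1))^-1.
Proof.
move=> /ler1_nat a1 t01; rewrite /step -natr1.
have -> : (a%:R + 1 + t)^-1 - (a%:R + t)^-1 = - ((a%:R + t) * (a%:R + 1 + t))^-1.
  by field; apply/andP; split; apply: lt0r_neq0; lra.
rewrite normrN ger0_norm ?invr_ge0 ?mulr_ge0//; try lra.
by rewrite lef_pV2 ?posrE; nra.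
Qed.

Lemma step_lip a s t : (0 < a)%N -> 0 <= s <= 1 -> 0 <= t <= 1 ->
  `|step a s - step a t| <= (a%:R ^+ 2)^-1 * `|s - t|.
Proof.
move=> /ler1_nat a1 s01 t01; rewrite /step.
have -> : (a%:R + s)^-1 - (a%:R + t)^-1 = - ((a%:R + s) * (a%:R + t))^-1 * (s - t).
  by field; apply/andP; split; apply: lt0r_neq0; lra.
rewrite normrM normrN ler_wpM2r// ger0_norm ?invr_ge0 ?mulr_ge0//; try lra.
by rewrite lef_pV2 ?posrE; nra.
Qed.

(** The variation of [trans f] splits into moving the points at fixed weights, with constant 5/8,
    and moving the weights at fixed points. The second part is summed by parts, so that the
    Lipschitz bound on [f] applies again, with constant 1/4. *)
Lemma trans_lip (L : R) f : (0 < M)%N -> 0 <= L -> lipschitz01 L f ->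
  lipschitz01 (7 / 8 * L) (trans f).
Proof.
move=> M0 L0 fL s t s01 t01.
have -> : trans f s - trans f t =
    \sum_(1 <= a < M.+2) pdig a s * (f (step a s) - f (step a t)) +
    \sum_(1 <= a < M.+2) ((ptail a s - ptail a t) -
      (ptail a.+1 s - ptail a.+1 t)) * f (step a t).
  by rewrite -sumrB -big_split/=; apply: eq_bigr => a _; rewrite /pdig; ring.
rewrite (sumr_by_parts (fun a => ptail a s - ptail a t)).
rewrite !ptail1// !ptail_over !subrr !mul0r subrr add0r.
(* [step a] has Lipschitz constant 1 for a = 1 and at most 1/4 for a >= 2. The digit 1 has
   probability 1 / (2 + s) <= 1/2, whence 1/2 + 1/2 * 1/4 = 5/8. *)
have first_sum : `|\sum_(1 <= a < M.+2) pdig a s * (f (step a s) - f (step a t))|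
    <= 5 / 8 * (L * `|s - t|).
  rewrite (le_trans (ler_norm_sum _ _ _))//.
  apply: (@le_trans _ _ (\sum_(1 <= a < M.+2)
      (pdig a s * (if a == 1%N then 1 else 4^-1)) * (L * `|s - t|))).
    rewrite big_nat_cond [leRHS]big_nat_cond; apply: ler_sum => a.
    rewrite andbT => /andP[a1 _].
    have p0 := pdig_ge0 a s a1 s01.
    rewrite normrM ger0_norm// -mulrA ler_wpM2l//.
    apply: le_trans (fL _ _ (step_itv _ _ a1 s01) (step_itv _ _ a1 t01)) _.
    rewrite mulrCA ler_wpM2l//.
    apply: le_trans (step_lip _ _ _ a1 s01 t01) _; rewrite ler_wpM2r//.
    case: eqP => [->|/eqP aN1]; first by rewrite expr1n invr1.
    have a2 : 2 <= a%:R :> R by rewrite (ler_nat _ 2); case: a a1 aN1 {p0} => [|[]].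
    by rewrite lef_pV2 ?posrE; nra.
  rewrite -mulr_suml ler_wpM2r ?mulr_ge0// big_ltn// eqxx mulr1.
  rewrite (eq_big_nat _ _ (F2 := fun a => pdig a s * 4^-1)); last first.
    by move=> [|[]].
  rewrite -mulr_suml sum_pdig_from// pdig_lt ?M0//.
  rewrite [X in X + _ <= _](_ : _ = (2 + s)^-1); last first.
    by field; rewrite !lt0r_neq0//; lra.
  rewrite [X in _ + X * _ <= _](_ : _ = 1 - (2 + s)^-1); last first.
    by field; rewrite !lt0r_neq0//; lra.
  suff : (2 + s)^-1 <= 2^-1 :> R by lra.
  by rewrite lef_pV2 ?posrE; lra.
(* [ptailB] and [stepB] multiply to 1 / (a + 1)^3, which is below 1 / (a (a + 1) (a + 2)). The
   latter telescopes to at most 1/4. *)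
have second_sum : `|\sum_(1 <= a < M.+1) (ptail a.+1 s - ptail a.+1 t) *
    (f (step a.+1 t) - f (step a t))| <= 1 / 4 * (L * `|s - t|).
  rewrite (le_trans (ler_norm_sum _ _ _))//.
  apply: (@le_trans _ _ (\sum_(1 <= a < M.+1)
      (- (2 * (a.+1%:R * (a.+1%:R + 1)))^-1 + (2 * (a%:R * (a%:R + 1)))^-1)
      * (L * `|s - t|))).
    rewrite big_nat_cond [leRHS]big_nat_cond; apply: ler_sum => a.
    rewrite andbT => /andP[a1 aM]; rewrite normrM.
    have aM' : (0 < a <= M)%N by rewrite a1.
    apply: le_trans (ler_pM (normr_ge0 _) (normr_ge0 _)
      (ptailB _ _ _ aM' s01 t01)
      (fL _ _ (step_itv _ _ (ltn0Sn a) t01) (step_itv _ _ a1 t01))) _.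
    have st := stepB a t a1 t01; have a1R := ler1_nat a a1.
    have d0 := normr_ge0 (s - t); move: `|s - t| d0 => d d0.
    apply: (@le_trans _ _ (a%:R / (a%:R + 1) ^+ 2 * d * (L * (a%:R * (a%:R + 1))^-1))).
      apply: ler_wpM2l; last exact: ler_wpM2l.
      by rewrite mulr_ge0 ?normr_ge0// divr_ge0// exprn_ge0//; lra.
    rewrite [leLHS](_ : _ = ((a%:R + 1) ^+ 3)^-1 * (L * d)); last first.
      by field; rewrite !lt0r_neq0//; lra.
    rewrite ler_wpM2r ?mulr_ge0// -natr1.
    rewrite [leRHS](_ : _ = (a%:R * (a%:R + 1) * (a%:R + 2))^-1); last first.
      by field; rewrite !lt0r_neq0//; lra.
    by rewrite lef_pV2 ?posrE ?mulr_gt0 ?exprn_gt0//; try nra.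
  rewrite -mulr_suml ler_wpM2r ?mulr_ge0//.
  rewrite (telescope_sumr_eq (fun a => - (2 * (a%:R * (a%:R + 1)))^-1))//; last first.
    by move=> a _; rewrite opprK.
  have : 0 <= (2 * (M.+1%:R * (M.+1%:R + 1)))^-1 :> R.
    by rewrite invr_ge0 !mulr_ge0// addr_ge0.
  have -> : (2 * (1%:R * (1%:R + 1)))^-1 = 1 / 4 :> R by field.
  by move: (2 * _)^-1 => w; lra.
apply: le_trans (ler_normD _ _) _; rewrite -mulrA.
lra.
Qed.
End digit_chain.

Lemma MVT_bounds {R : realType} (f df : R -> R) (a b lo hi : R) : a <= b ->
  (forall x, a <= x <= b -> is_derive x 1 f (df x)) ->
  (forall x, a <= x <= b -> lo <= df x <= hi) ->
  lo * (b - a) <= f b - f a <= hi * (b - a).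
Proof.
move=> ab fd dfb.
have [||c] := @MVT_segment _ f df _ _ ab.
- by move=> x; rewrite in_itv/= => /andP[ax xb]; apply: fd; rewrite !ltW.
- apply: derivable_within_continuous => x.
  by rewrite in_itv/= => /fd dx; exact: ex_derive.
rewrite in_itv/= => /dfb /andP[lc ch] ->.
have ba0 : 0 <= b - a by rewrite subr_ge0.
by rewrite !ler_wpM2r.
Qed.

Lemma is_derive_sum_nat {R : realType} (h dh : nat -> R -> R) (x : R) m n :
  (forall a, (m <= a < n)%N -> is_derive x 1 (h a) (dh a x)) ->
  is_derive x 1 (fun t => \sum_(m <= a < n) h a t) (\sum_(m <= a < n) dh a x).
Proof.
elim: n => [|n IH] hd.
  by rewrite big_geq//; under eq_fun do rewrite big_geq//; exact: is_derive_cst.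
have [mn|nm] := leqP m n; last first.
  rewrite big_geq//; under eq_fun do rewrite big_geq//; exact: is_derive_cst.
rewrite big_nat_recr//=; under eq_fun do rewrite big_nat_recr//=.
apply: is_deriveD; first by apply: IH => a /andP[ma an]; apply: hd; rewrite ma leqW.
by apply: hd; rewrite mn leqnn.
Qed.

Lemma ln2_ge {R : realType} : 1 / 2 <= ln 2 :> R.
Proof.
have := @le_ln1Dx R (- (1 / 2)) ltac:(lra).
have -> : 1 + - (1 / 2) = 2^-1 :> R by lra.
by rewrite lnV ?posrE//; lra.
Qed.

(** * Integrals against the Gauss density *)

Section gauss_density.
Context {R : realType} (M : nat).
Implicit Types (s t : R) (f : R -> R).
Local Notation pdig := (@pdig R M).
Local Notation trans := (@trans R M).

(* [gauss_mass f I]: the integral of f t / (1 + t) over [0, 1] is I. *)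
Definition gauss_mass f (I : R) := exists2 Phi : R -> R,
  (forall t, 0 <= t <= 1 -> is_derive t 1 Phi (f t / (1 + t)))
  & Phi 1 - Phi 0 = I.

(* Dropping the letter M.+1 makes the operator dual to the Gauss map restricted
   to digits at most M, which keeps track of the mass exactly. *)
Definition subtrans f s : R := \sum_(1 <= a < M.+1) pdig a s * f (step a s).

(** Since k / (1 + t) has primitive k ln (1 + t), subtracting it from [Phi] with k = [lo] or k =
    [hi] leaves a monotone function. Only the bound 0 on its derivative matters; the other one is
    crude. *)
Lemma gauss_mass_bounds f I lo hi :
  gauss_mass f I -> (forall t, 0 <= t <= 1 -> lo <= f t <= hi) ->
  lo * ln 2 <= I <= hi * ln 2.
Proof.
move=> [Phi dPhi <-] fb.
have dlnS t : 0 <= t <= 1 -> is_derive t 1 (fun u : R => ln (1 + u)) ((1 + t)^-1).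
  move=> t01; have t0 : 0 < 1 + t by lra.
  have := is_derive1_comp (is_derive1_ln t0)
    (is_deriveD (is_derive_cst (1 : R) t 1) (is_derive_id t (1 : R))).
  by rewrite add0r mulr1.
have dD k t : 0 <= t <= 1 ->
    is_derive t 1 (fun u => Phi u - k * ln (1 + u)) ((f t - k) / (1 + t)).
  move=> t01; have H1 := dPhi t t01; have H2 := dlnS t t01.
  rewrite [_ / _](_ : _ = f t / (1 + t) - k *: (1 + t)^-1).
    exact: is_deriveB H1 (is_deriveZ k H2).
  by rewrite /GRing.scale/=; ring.
have b01 : 0 <= 1 :> R by [].
have fd0 k t : 0 <= t <= 1 -> (f t - k) / (1 + t) * (1 + t) = f t - k.
  by move=> t01; rewrite divfK//; apply: lt0r_neq0; lra.
apply/andP; split.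
- have := MVT_bounds _ _ 0 1 0 ((hi - lo)) b01 (dD lo).
  case/(_ _)/andP => [t t01|]; last by rewrite addr0 ln1 mul0r mulr0; lra.
  have := fb t t01; have := fd0 lo t t01.
  by move: (_ / _) => w; nra.
- have := MVT_bounds _ _ 0 1 (lo - hi) 0 b01 (dD hi).
  case/(_ _)/andP => [t t01|]; last by rewrite addr0 ln1 mul0r mulr0; lra.
  have := fb t t01; have := fd0 hi t t01.
  by move: (_ / _) => w; nra.
Qed.

(** Change of variables on each branch: the primitive of the image sums Phi (1 / a) - Phi (1 / (a +
    t)), and at t = 1 this telescopes to Phi 1 - Phi (1 / (M + 1)). The lost mass is that of [f] on
    [0, 1 / (M + 1)], where the integrand is at most 2. *)
Lemma gauss_mass_subtrans f I :
  (forall t, 0 <= t <= 1 -> 0 <= f t <= 2) -> gauss_mass f I ->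
  exists2 J : R, I - 2 / M.+1%:R <= J <= I & gauss_mass (subtrans f) J.
Proof.
move=> fb [Phi dPhi <-]; exists (Phi 1 - Phi (M.+1%:R^-1)).
  have M1 : 1 <= M.+1%:R :> R by rewrite (ler_nat _ 1).
  have i1 : M.+1%:R^-1 <= 1 :> R by rewrite invf_le1 ?ltr0Sn.
  have i0 : 0 <= M.+1%:R^-1 :> R by rewrite invr_ge0.
  have := @MVT_bounds _ Phi (fun t => f t / (1 + t)) 0 (M.+1%:R^-1) 0 2 i0.
  case/(_ _ _)/andP.
  - by move=> x /andP[x0 xi]; apply: dPhi; rewrite x0 (le_trans xi).
  - move=> x xi; have x01 : 0 <= x <= 1 by case/andP: xi => -> /le_trans; apply.
    have := fb x x01; move=> /andP[f0 f2]; rewrite divr_ge0 ?ler_pdivrMr//; nra.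
  - by move: (_^-1) => w; lra.
exists (fun t => \sum_(1 <= a < M.+1) (Phi (a%:R^-1) - Phi (step a t))); last first.
  rewrite -sumrB.
  rewrite (telescope_sumr_eq (fun a => - Phi (a%:R^-1)))// => [|a _].
    by rewrite invr1; ring.
  by rewrite /step addr0 natr1; ring.
move=> t t01.
pose dh a t := pdig a t * f (step a t) / (1 + t).
rewrite (_ : _ / _ = \sum_(1 <= a < M.+1) dh a t); last first.
  by rewrite /subtrans mulr_suml.
apply: is_derive_sum_nat => a /andP[a1 aM]; rewrite /dh pdig_lt ?a1//.
have a1R := ler1_nat a a1 : 1 <= a%:R :> R.
have dstep : is_derive t 1 (step a : R -> R) (- (a%:R + t) ^- 2).
  have at0 : a%:R + t != 0 by apply: lt0r_neq0; lra.
  have := @is_deriveV _ (fun u => a%:R + u) _ _ _ at0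
    (is_deriveD (is_derive_cst (a%:R : R) t 1) (is_derive_id t (1 : R))).
  by rewrite /GRing.scale/= add0r mulr1.
have Hc := is_derive1_comp (dPhi _ (step_itv _ _ a1 t01)) dstep.
have := is_deriveB (is_derive_cst (Phi a%:R^-1) t 1) Hc; congr is_derive.
rewrite /step -natr1; field.
by rewrite !lt0r_neq0//; lra.
Qed.
End gauss_density.

(** * Exponential convergence in the Gauss-Kuzmin theorem *)

Section gauss_kuzmin.
Context {R : realType} (M : nat).
Implicit Types (s t : R) (f g : R -> R).
Local Notation pdig := (@pdig R M).
Local Notation trans := (@trans R M).
Local Notation subtrans := (@subtrans R M).

Lemma ler_trans f g s : 0 <= s <= 1 ->
  (forall t, 0 <= t <= 1 -> f t <= g t) -> trans f s <= trans g s.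
Proof.
move=> s01 fg; rewrite /trans big_nat_cond [leRHS]big_nat_cond.
apply: ler_sum => a; rewrite andbT => /andP[a1 _].
by rewrite ler_wpM2l ?pdig_ge0// fg// step_itv.
Qed.

Lemma trans_cst (k : R) s : 0 <= s <= 1 -> trans (fun=> k) s = k.
Proof. by move=> s01; rewrite /trans -mulr_suml sum_pdig ?mul1r. Qed.

Lemma trans_bounds lo hi f s : 0 <= s <= 1 ->
  (forall t, 0 <= t <= 1 -> lo <= f t <= hi) -> lo <= trans f s <= hi.
Proof.
move=> s01 fb; rewrite -[X in X <= trans f s](trans_cst _ s s01).
rewrite -[X in _ && (_ <= X)](trans_cst _ s s01).
by apply/andP; split; apply: ler_trans => // t /fb /andP[].
Qed.

Lemma trans_split f s :
  trans f s = subtrans f s + pdig M.+1 s * f (step M.+1 s).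
Proof. by rewrite /trans big_nat_recr. Qed.

Lemma pdig_last_le s : 0 <= s <= 1 -> pdig M.+1 s <= 2 / M.+1%:R.
Proof.
move=> s01; have M1 : 1 <= M.+1%:R :> R by rewrite (ler_nat _ 1).
by rewrite pdig_last ler_pM ?invr_ge0 ?lef_pV2 ?posrE; lra.
Qed.

(* [kuzmin m s] is the conditional expectation of 1 + s_m given s_0 = s. *)
Definition kuzmin m : R -> R := iter m trans (fun s => 1 + s).

Lemma kuzmin_bounds m s : 0 <= s <= 1 -> 1 <= kuzmin m s <= 2.
Proof.
elim: m s => [|m IH] s s01 /=; first by rewrite /kuzmin/=; lra.
exact: trans_bounds.
Qed.

Lemma kuzmin_lip m : (0 < M)%N -> lipschitz01 ((7 / 8) ^+ m) (kuzmin m).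
Proof.
move=> M0; elim: m => [|m IH].
  by move=> u v _ _; rewrite expr0 mul1r /kuzmin/= (_ : 1 + u - (1 + v) = u - v)//; ring.
by rewrite exprS; apply: trans_lip => //; rewrite exprn_ge0//; lra.
Qed.

Lemma subtrans_bounds e f s : 0 <= s <= 1 ->
  (forall t, 0 <= t <= 1 -> 0 <= f t <= e) -> 0 <= subtrans f s <= e.
Proof.
move=> s01 fb; apply/andP; split.
  rewrite /subtrans big_nat_cond; apply: sumr_ge0 => a.
  rewrite andbT => /andP[a1 _]; rewrite mulr_ge0 ?pdig_ge0//.
  by have /andP[] := fb _ (step_itv _ _ a1 s01).
have /andP[_] := trans_bounds _ _ _ _ s01 fb; apply: le_trans.
rewrite trans_split lerDl mulr_ge0 ?pdig_ge0//.
by have /andP[] := fb _ (step_itv _ _ (ltn0Sn M) s01).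
Qed.

Lemma subtransB f g s :
  subtrans f s - subtrans g s = subtrans (fun t => f t - g t) s.
Proof. by rewrite /subtrans -sumrB; apply: eq_bigr => a _; rewrite mulrBr. Qed.

(** Each step drops the merged letter, of probability at most 2 / (M + 1), on which the function is
    at most 2; hence a loss of 4 / (M + 1) per step. *)
Lemma iter_subtrans_kuzmin m s : 0 <= s <= 1 ->
  0 <= iter m subtrans (fun s => 1 + s) s <= 2
  /\ 0 <= kuzmin m s - iter m subtrans (fun s => 1 + s) s <= 4 * m%:R / M.+1%:R.
Proof.
have M0 : 0 <= M.+1%:R^-1 :> R by rewrite invr_ge0.
elim: m s => [|m IH] s s01.
  by rewrite mulr0 mul0r /kuzmin/= subrr lexx; split => //; lra.
have kE : kuzmin m.+1 s = trans (kuzmin m) s by [].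
rewrite iterS kE; set g := iter m _ _ in IH *.
split; first by apply: subtrans_bounds => // t /IH[].
rewrite trans_split addrAC subtransB.
have /andP[d0 d1] := subtrans_bounds _ (fun t => kuzmin m t - g t) _ s01
  (fun t t01 => (IH t t01).2).
have sM01 := step_itv _ _ (ltn0Sn M) s01.
have /andP[k0 k2] := kuzmin_bounds m _ sM01.
have p0 := pdig_ge0 M _ _ (ltn0Sn M) s01; have p2 := pdig_last_le s s01.
rewrite addr_ge0 ?mulr_ge0//; last by lra.
have -> : 4 * m.+1%:R / M.+1%:R = 4 * m%:R / M.+1%:R + 2 / M.+1%:R * 2 :> R.
  by rewrite -(natr1 m); ring.
by rewrite lerD// ler_pM//; lra.
Qed.

(** The density cancels 1 + s, so the initial mass is exactly 1; each step then loses at most 2 / (M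
    + 1). *)
Lemma iter_subtrans_mass m : exists2 J : R, 1 - 2 * m%:R / M.+1%:R <= J <= 1
  & gauss_mass (iter m subtrans (fun s => 1 + s)) J.
Proof.
elim: m => [|m [J /andP[J0 J1] mJ]].
  exists 1; first by rewrite mulr0 mul0r subr0 lexx.
  exists id; last by rewrite subr0.
  move=> t t01; rewrite divff; first by exact: is_derive_id.
  by case/andP: t01 => t0 _; rewrite lt0r_neq0// ltr_wpDr.
have [|K /andP[K0 K1] mK] := gauss_mass_subtrans M _ _ _ mJ.
  by move=> t t01; have [] := iter_subtrans_kuzmin m _ t01.
exists K => //; rewrite (le_trans K1)// andbT (le_trans _ K0)//.
rewrite -(natr1 m) mulrDr mulrDl mulr1.
by move: (2 * _ / _) (2 / _) J0 K0 => x y; lra.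
Qed.

(** By contraction [kuzmin m] oscillates by at most (7/8)^m, and the sub-Markov iterate stays within
    4 m / (M + 1) below it. That iterate has Gauss mass close to 1 while constants have mass ln 2
    times their value, which pins the value to 1 / ln 2. *)
Lemma kuzmin_limit m s : (0 < M)%N -> 0 <= s <= 1 ->
  `|kuzmin m s - (ln 2)^-1| <= (7 / 8) ^+ m + 4 * m%:R / M.+1%:R.
Proof.
move=> M0 s01; have [J /andP[J0 J1] mJ] := iter_subtrans_mass m.
have l2 := @ln2_ge R; have l20 : ln 2 != 0 :> R by apply: lt0r_neq0; lra.
have := @divr_ge0 R m%:R M.+1%:R (ler0n _ _) (ler0n _ _).
have := fun t => iter_subtrans_kuzmin m t; rewrite -!mulrA.
rewrite -!mulrA in J0; move: (m%:R / M.+1%:R : R) J0 => d J0 sub d0.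
set r : R := (7 / 8) ^+ m.
have := gauss_mass_bounds _ _ (kuzmin m s - r - 4 * d) (kuzmin m s + r) mJ.
case/(_ _)/andP => [t t01|lo hi].
  have [_ /andP[g0 g1]] := sub t t01.
  have := kuzmin_lip m M0 s t s01 t01; rewrite -/r => lip.
  have r0 : 0 <= r by rewrite exprn_ge0// divr_ge0.
  have {}lip : `|kuzmin m s - kuzmin m t| <= r.
    apply: le_trans lip _; rewrite ler_piMr//.
    by rewrite ler_norml; lra.
  by move: lip; rewrite ler_norml; lra.
set c := (ln 2)^-1; have cl : c * ln 2 = 1 by rewrite mulVf.
have c0 : 0 < c by rewrite invr_gt0; lra.
have c2 : c <= 2 by move: l2 cl; nra.
have {lo} lo : kuzmin m s - r - 4 * d <= c.
  by rewrite -(ler_pM2r (_ : 0 < ln 2)) ?cl; lra.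
have {hi} hi : c - 2 * d * c <= kuzmin m s + r.
  rewrite -(ler_pM2r (_ : 0 < ln 2)); last lra.
  apply: le_trans hi; rewrite (_ : _ * ln 2 = 1 - 2 * d)//.
  by rewrite mulrBl -[2 * d * c * _]mulrA cl mulr1.
by rewrite ler_norml; apply/andP; split; nra.
Qed.
End gauss_kuzmin.

(** For the upper bound, exp (- t) <= 1 / (1 + t) = 1 - t + t^2 / (1 + t). *)
Lemma expRN_taylor {R : realType} (t : R) : 0 <= t ->
  0 <= expR (- t) - 1 + t <= t ^+ 2.
Proof.
move=> t0; apply/andP; split; first by have := expR_ge1Dx (- t); lra.
have t1 : 0 < 1 + t by lra.
have : expR (- t) <= (1 + t)^-1.
  by rewrite expRN lef_pV2 ?posrE ?expR_gt0// expR_ge1Dx.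
have : (1 + t)^-1 * (1 + t) = 1 by rewrite mulVf ?lt0r_neq0.
by move: (expR _) (_^-1) => x y; nra.
Qed.

(** * Generating functions of digit counts *)

Section weighted_transfer.
Context {R : realType} (M : nat) (w : nat -> R).
Hypothesis w01 : forall a, 0 <= w a <= 1.
Implicit Types (s t : R) (f g : R -> R).
Local Notation pdig := (@pdig R M).
Local Notation trans := (@trans R M).
Local Notation kuzmin := (@kuzmin R M).

Definition wtrans f s : R :=
  \sum_(1 <= a < M.+2) pdig a s * (w a * f (step a s)).

(** On [0, 1] this is 1 minus the image of the constant 1 under [wtrans], hence the size of the
    perturbation of [trans]. *)
Definition wloss s : R := \sum_(1 <= a < M.+2) pdig a s * (1 - w a).

Lemma wtransB f g s : wtrans f s - wtrans g s = wtrans (fun t => f t - g t) s.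
Proof. by rewrite /wtrans -sumrB; apply: eq_bigr => a _; ring. Qed.

Lemma wtransZ k f s : wtrans (fun t => k * f t) s = k * wtrans f s.
Proof. by rewrite /wtrans mulr_sumr; apply: eq_bigr => a _; ring. Qed.

Lemma wtrans_norm k f s : 0 <= s <= 1 ->
  (forall t, 0 <= t <= 1 -> `|f t| <= k) -> `|wtrans f s| <= k.
Proof.
move=> s01 fk; rewrite (le_trans (ler_norm_sum _ _ _))//.
rewrite -[leRHS](trans_cst M k s s01) /trans big_nat_cond [leRHS]big_nat_cond.
apply: ler_sum => a; rewrite andbT => /andP[a1 _].
have p0 := pdig_ge0 M a s a1 s01; rewrite normrM ger0_norm// ler_wpM2l//.
have /andP[w0 w1] := w01 a; rewrite normrM ger0_norm//.
have := fk _ (step_itv _ _ a1 s01); have := normr_ge0 (f (step a s)).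
by move: (`|f _|) => x; nra.
Qed.

Lemma iter_wtrans_norm n k f s : 0 <= s <= 1 ->
  (forall t, 0 <= t <= 1 -> `|f t| <= k) -> `|iter n wtrans f s| <= k.
Proof.
by move=> + fk; elim: n s => [|n IH] s s01; [exact: fk|exact: wtrans_norm].
Qed.

(** Truncated Neumann series for the Poisson equation. The limit 1 / ln 2 need not be subtracted
    from the terms, as [trans] fixes constants. *)
Definition kuzmin_sum m s : R := \sum_(0 <= k < m) kuzmin k s.

Lemma kuzmin_sum_bounds m s : 0 <= s <= 1 -> 0 <= kuzmin_sum m s <= 2 * m%:R.
Proof.
move=> s01; elim: m => [|m /andP[IH0 IH2]].
  by rewrite /kuzmin_sum big_geq// mulr0 lexx.
rewrite /kuzmin_sum big_nat_recr//= -/(kuzmin_sum m s) -natr1.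
by have := kuzmin_bounds M m s s01; lra.
Qed.

Lemma trans_kuzmin_sum m s :
  trans (kuzmin_sum m) s = kuzmin_sum m s - (1 + s) + kuzmin m s.
Proof.
transitivity (\sum_(0 <= k < m) kuzmin k.+1 s).
  rewrite /trans /kuzmin_sum; under eq_bigr do rewrite mulr_sumr.
  by rewrite exchange_big.
rewrite /kuzmin_sum -[X in _ = X + _ + _]addr0.
elim: m => [|m IH]; first by rewrite !big_geq// //=; ring.
by rewrite !big_nat_recr//= IH; ring.
Qed.

Section eigenvalue.
Variables (m : nat) (delta eta e : R).
Let c : R := (ln 2)^-1.
Let h := kuzmin_sum m.
Let u s := 1 - delta * h s.
Let E := expR (- (c * delta)).
Hypotheses (m0 : (0 < m)%N) (delta0 : 0 <= delta) (mdelta : 2 * m%:R * delta <= 1).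
Hypothesis wloss_delta : forall s, 0 <= s <= 1 ->
  `|wloss s - delta * (1 + s)| <= eta.
Hypothesis kuzmin_e : forall s, 0 <= s <= 1 -> `|kuzmin m s - c| <= e.

Let err := delta * e + 2 * eta + 12 * (m%:R * delta ^+ 2).

(* [1 - delta * h] is an eigenfunction up to second order in delta, because h
   solves the Poisson equation h - P h = (1 + s) - c up to the error e. *)
Lemma wtrans_eigen s : 0 <= s <= 1 -> `|wtrans u s - E * u s| <= err.
Proof.
move=> s01; have m1 := @ler1_nat R m m0.
(* [X] is the cross term between the loss and the corrector; multiplied by [delta] it is of second
   order. *)
pose X : R := \sum_(1 <= a < M.+2) pdig a s * (1 - w a) * h (step a s).
have uE : wtrans u s =
    1 - delta * (h s - (1 + s) + kuzmin m s) - wloss s + delta * X.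
  rewrite -trans_kuzmin_sum -[in RHS](trans_cst M 1 s s01) /trans /wloss /X !mulr_sumr.
  rewrite -!sumrB -big_split/=; apply: eq_bigr => a _.
  by rewrite /u /h; ring.
have q0 : 0 <= wloss s.
  rewrite /wloss big_nat_cond; apply: sumr_ge0 => a.
  rewrite andbT => /andP[a1 _]; rewrite mulr_ge0 ?pdig_ge0// subr_ge0.
  by case/andP: (w01 a).
have X0 : 0 <= X <= 2 * m%:R * wloss s.
  rewrite /X /wloss mulr_sumr; apply/andP; split.
    rewrite big_nat_cond; apply: sumr_ge0 => a.
    rewrite andbT => /andP[a1 _]; have /andP[w0 w1] := w01 a.
    have /andP[h0 _] := kuzmin_sum_bounds m _ (step_itv _ _ a1 s01).
    by rewrite !mulr_ge0 ?pdig_ge0// subr_ge0.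
  rewrite big_nat_cond [leRHS]big_nat_cond; apply: ler_sum => a.
  rewrite andbT => /andP[a1 _]; have /andP[w0 w1] := w01 a.
  rewrite mulrC ler_wpM2r//; first by rewrite mulr_ge0 ?pdig_ge0// subr_ge0.
  by have /andP[_] := kuzmin_sum_bounds m _ (step_itv _ _ a1 s01).
have /andP[h0 h2] := kuzmin_sum_bounds m s s01.
have := wloss_delta s s01; have := kuzmin_e s s01; rewrite !ler_norml.
have l2 := @ln2_ge R.
have cl : c * ln 2 = 1 by rewrite mulVf//; apply: lt0r_neq0; lra.
have c0 : 0 < c by rewrite invr_gt0; lra.
have c2 : c <= 2 by move: l2 cl; nra.
have cd0 : 0 <= c * delta by rewrite mulr_ge0// ltW.
have /andP[r0 r1] := expRN_taylor _ cd0.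
rewrite uE /u /err -/E -/(h s) in h0 h2 r0 r1 *.
move: (wloss s) q0 X0 => q q0 /andP[X0 X1] /andP[k0 k1] /andP[q1 q2].
have eta0 : 0 <= eta by lra.
have b1 : 0 <= delta * X <= 4 * (m%:R * delta ^+ 2) + eta.
  have p1 := mulr_ge0 delta0 X0; rewrite p1/=.
  have p2 := ler_wpM2l delta0 X1.
  have p3 : q <= 2 * delta + eta by nra.
  have p4 := ler_wpM2l (mulr_ge0 (mulr_ge0 (ler0n R 2) (ler0n R m)) delta0) p3.
  have p5 := ler_wpM2r eta0 mdelta.
  nra.
have b2 : 0 <= c * delta ^+ 2 * h s <= 4 * (m%:R * delta ^+ 2).
  have d2 := sqr_ge0 delta; have p1 := mulr_ge0 (mulr_ge0 (ltW c0) d2) h0.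
  rewrite p1/=.
  have p2 := ler_wpM2l (mulr_ge0 (ltW c0) d2) h2.
  have p3 := ler_wpM2r (mulr_ge0 d2 (ler0n R m)) c2.
  nra.
pose r := E - 1 + c * delta.
have u01 : 0 <= 1 - delta * h s <= 1.
  have p1 := ler_wpM2l delta0 h2; have p2 := mulr_ge0 delta0 h0.
  by move: mdelta p1 p2; rewrite (mulrC _ delta); move: (delta * h s) => y; lra.
have b3 : 0 <= r * (1 - delta * h s) <= 4 * (m%:R * delta ^+ 2).
  have /andP[u0 u1] := u01; rewrite mulr_ge0//=.
  have p1 := ler_wpM2l r0 u1; have d2 := sqr_ge0 delta.
  have p2 : (c * delta) ^+ 2 <= 4 * delta ^+ 2.
    by rewrite exprMn ler_wpM2r//; nra.
  have p3 := ler_wpM2r d2 m1.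
  by rewrite -/r in r1 p1; lra.
have b4 : - (delta * e) <= delta * (c - kuzmin m s) <= delta * e.
  by rewrite -mulrN !ler_wpM2l//; lra.
(* With E = 1 - c delta + r, the first-order terms cancel up to the errors in the loss and in
   [kuzmin m]. The terms bounded by [b1], [b2] and [b3] cost 4 m delta^2 each, whence the 12 in
   [err], and [b1] costs a second [eta]. *)
rewrite [X in _ <= X <= _](_ : _ = delta * (1 + s) - q + delta * (c - kuzmin m s)
   + delta * X - c * delta ^+ 2 * h s - r * (1 - delta * h s)); last first.
  by rewrite /r; ring.
apply/andP; split; lra.
Qed.

(** [wtrans] does not increase sup norms, so replacing 1 by [u] costs 2 m delta at the start and
    again at the end, and each of the n steps adds one eigenfunction error. *)
Lemma iter_wtrans_exp n s : 0 <= s <= 1 ->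
  `|iter n wtrans (fun=> 1) s - expR (- (c * delta * n%:R))|
  <= 4 * m%:R * delta + n%:R * err.
Proof.
move=> s01.
have E0 : 0 <= E by exact: expR_ge0.
have E1 : E <= 1.
  have l2 := @ln2_ge R; rewrite -expR0 ler_expR oppr_le0 mulr_ge0//.
  by rewrite invr_ge0; lra.
have step1 k t : 0 <= t <= 1 -> `|iter k wtrans u t - E ^+ k * u t| <= k%:R * err.
  elim: k t => [|k IH] t t01; first by rewrite expr0 mul1r subrr normr0 mul0r.
  have -> : iter k.+1 wtrans u t - E ^+ k.+1 * u t =
      wtrans (fun t => iter k wtrans u t - E ^+ k * u t) t
      + E ^+ k * (wtrans u t - E * u t).
    by rewrite -wtransB wtransZ /= exprSr; ring.
  apply: le_trans (ler_normD _ _) _; rewrite -natr1 mulrDl mul1r lerD//.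
    exact: wtrans_norm.
  rewrite normrM ger0_norm ?exprn_ge0// -[leRHS]mul1r ler_pM ?exprn_ge0//.
    by rewrite exprn_ile1.
  exact: wtrans_eigen.
have ud t : 0 <= t <= 1 -> `|1 - u t| <= 2 * m%:R * delta.
  move=> t01; have /andP[h0 h2] := kuzmin_sum_bounds m t t01.
  rewrite /u opprB addrC subrK ger0_norm ?mulr_ge0//.
  by rewrite mulrC ler_wpM2r.
have iterB k t : iter k wtrans (fun=> 1) t - iter k wtrans u t =
    iter k wtrans (fun t => 1 - u t) t.
  elim: k t => [//|k IH] t; rewrite !iterS wtransB.
  by congr wtrans; apply/funext => x; rewrite IH.
have -> : expR (- (c * delta * n%:R)) = E ^+ n.
  by rewrite /E -expRM_natr; congr expR; ring.
have -> : iter n wtrans (fun=> 1) s - E ^+ n =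
    (iter n wtrans (fun=> 1) s - iter n wtrans u s)
    + (iter n wtrans u s - E ^+ n * u s) - E ^+ n * (1 - u s) by ring.
have T1 : `|iter n wtrans (fun=> 1) s - iter n wtrans u s| <= 2 * m%:R * delta.
  by rewrite iterB; apply: iter_wtrans_norm.
have T2 := step1 n s s01.
have T3 : `|E ^+ n * (1 - u s)| <= 2 * m%:R * delta.
  rewrite normrM ger0_norm ?exprn_ge0// -[leRHS]mul1r ler_pM ?exprn_ge0//.
    by rewrite exprn_ile1.
  exact: ud.
apply: le_trans (ler_normB _ _) _.
apply: le_trans (lerD (ler_normD _ _) (lexx _)) _.
move: T1 T2 T3; move: `|_| `|_| `|_| (n%:R * _) => a b d k; lra.
Qed.
End eigenvalue.
End weighted_transfer.

(** * Expectations over random words and second moments of digit counts *)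

Section digit_expectation.
Context {R : realType} (M : nat).
Implicit Types (l : seq nat) (F G : seq nat -> R).
Local Notation pdig := (@pdig R M).

(* Words of digits are stored with the most recent digit first. *)
Definition state l : R := foldr step 0 l.
Definition digits_pos l := all (leq 1) l.

Fixpoint expect n F l : R :=
  if n is k.+1 then \sum_(1 <= a < M.+2) pdig a (state l) * expect k F (a :: l)
  else F l.

Lemma state_itv l : digits_pos l -> 0 <= state l <= 1.
Proof.
elim: l => [_|a l IH /andP[a1 /IH]]; first by rewrite /state/= lexx ler01.
exact: step_itv.
Qed.

Lemma ler_expect n F G l : digits_pos l ->
  (forall l', digits_pos l' -> F l' <= G l') -> expect n F l <= expect n G l.
Proof.
move=> + FG; elim: n l => [|n IH] l lp /=; first exact: FG.
rewrite big_nat_cond [leRHS]big_nat_cond.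
apply: ler_sum => a; rewrite andbT => /andP[a1 _].
by rewrite ler_wpM2l ?pdig_ge0 ?state_itv//; apply: IH; rewrite /= a1.
Qed.

Lemma expect_cst n k l : digits_pos l -> expect n (fun=> k) l = k.
Proof.
elim: n l => [//|n IH] l lp /=.
rewrite (eq_big_nat _ _ (F2 := fun a => pdig a (state l) * k)).
  by rewrite -mulr_suml sum_pdig ?mul1r ?state_itv.
by move=> a /andP[a1 _]; rewrite IH//= a1.
Qed.

Lemma eq_expect n F G l : F =1 G -> expect n F l = expect n G l.
Proof. by move=> /funext ->. Qed.

Lemma expectZ n k F l : expect n (fun l' => k * F l') l = k * expect n F l.
Proof.
elim: n l => [//|n IH] l /=; rewrite mulr_sumr.
by apply: eq_bigr => a _; rewrite IH mulrCA.
Qed.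

Lemma expectD n F G l :
  expect n (fun l' => F l' + G l') l = expect n F l + expect n G l.
Proof.
elim: n l => [//|n IH] l /=; rewrite -big_split/=.
by apply: eq_bigr => a _; rewrite IH mulrDr.
Qed.

Lemma expect_sum (I : Type) (r : seq I) n (F : I -> seq nat -> R) l :
  expect n (fun l' => \sum_(i <- r) F i l') l = \sum_(i <- r) expect n (F i) l.
Proof.
elim: n l => [//|n IH] l /=; rewrite exchange_big/=.
by apply: eq_bigr => a _; rewrite IH mulr_sumr.
Qed.

(** A product over letters picks up one weight per step of the chain, which turns generating
    functions of counts into iterates of [wtrans]. *)
Lemma expect_prod w n l : expect n (fun l' => \prod_(a <- l') w a) l =
  (\prod_(a <- l) w a) * iter n (wtrans M w) (fun=> 1) (state l).
Proof.
elim: n l => [|n IH] l /=; first by rewrite mulr1.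
rewrite /wtrans mulr_sumr; apply: eq_bigr => a _.
by rewrite IH big_cons /=; ring.
Qed.

(** Over a common denominator of size at least a^4, the numerator of the difference is at most 2 * 5
    a. *)
Lemma pdig_approx a (s : R) : (0 < a <= M)%N -> 0 <= s <= 1 ->
  `|pdig a s - (a%:R ^+ 2)^-1 * (1 + s)| <= 10 * (a%:R ^+ 3)^-1.
Proof.
move=> aM s01; rewrite pdig_lt//; have a0 : (0 < a)%N by case/andP: aM.
have := ler1_nat a a0 : 1 <= a%:R :> R; rewrite -natr1; move: (a%:R : R) => x x1.
have -> : (1 + s) / ((x + s) * (x + 1 + s)) - (x ^+ 2)^-1 * (1 + s) =
  - ((1 + s) * (x * (1 + 2 * s) + s * (1 + s)) / (x ^+ 2 * ((x + s) * (x + 1 + s)))).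
  by field; rewrite !lt0r_neq0//; lra.
have d0 : 0 < x ^+ 2 * ((x + s) * (x + 1 + s)).
  by rewrite !mulr_gt0 ?exprn_gt0//; lra.
have s0 : 0 <= s by case/andP: s01.
have x0 : 0 <= x by exact: le_trans x1.
have sx : x * s <= x by rewrite ler_piMr//; case/andP: s01.
have ss : s * s <= s by rewrite ler_piMr//; case/andP: s01.
have xs0 : 0 <= x * s by rewrite mulr_ge0.
rewrite normrN ger0_norm; last first.
  by rewrite divr_ge0 ?(ltW d0)// mulr_ge0 ?addr_ge0 ?mulr_ge0// ?addr_ge0 ?mulr_ge0.
rewrite ler_pdivrMr//.
have -> : 10 / x ^+ 3 * (x ^+ 2 * ((x + s) * (x + 1 + s)))
    = 10 * ((x + s) * (x + 1 + s)) / x.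
  by field; apply: lt0r_neq0; lra.
rewrite ler_pdivlMr; last lra.
have n1 : (1 + s) * (x * (1 + 2 * s) + s * (1 + s)) <= 10 * x.
  apply: (@le_trans _ _ (2 * (5 * x))); last lra.
  by rewrite ler_pM ?addr_ge0 ?mulr_ge0 ?addr_ge0 ?mulr_ge0//; lra.
have n2 : x * x <= (x + s) * (x + 1 + s) by rewrite ler_pM//; lra.
apply: le_trans (ler_wpM2r x0 n1) _.
by rewrite -mulrA ler_wpM2l.
Qed.

Section moments.
Variables (z : R) (lo hi n : nat).
Hypotheses (z01 : 0 <= z <= 1) (lo0 : (0 < lo)%N) (hiM : (hi <= M)%N).
Let c : R := (ln 2)^-1.

Definition mark (r : seq nat) (a : nat) : R := if a \in r then z else 1.

Lemma mark01 r a : 0 <= mark r a <= 1.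
Proof. by rewrite /mark; case: ifP => // _; rewrite ler01 lexx. Qed.

Lemma wloss_mark r s : uniq r -> {in r, forall a, (lo < a <= hi)%N} ->
  wloss M (mark r) s = \sum_(a <- r) (1 - z) * pdig a s.
Proof.
move=> ur rb; rewrite /wloss.
rewrite (eq_bigr (fun a => if a \in r then (1 - z) * pdig a s else 0)); last first.
  by move=> a _; rewrite /mark; case: ifP => _; ring.
rewrite -big_mkcond -big_filter; apply: perm_big; apply: uniq_perm => //.
  by rewrite filter_uniq// iota_uniq.
move=> a; rewrite mem_filter mem_index_iota; case: (boolP (a \in r)) => //= /rb.
by move=> /andP[la ah]; rewrite (leq_trans lo0 (ltnW la)) ltnS leqW// (leq_trans ah).
Qed.

Lemma prod_mark r l : uniq r ->
  \prod_(a <- l) mark r a = \prod_(x <- r) z ^+ count_mem x l.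
Proof.
move=> ur; elim: l => [|a l IH] /=.
  by rewrite big_nil big1.
rewrite big_cons IH.
under [RHS]eq_bigr do rewrite exprD.
rewrite big_split/=; congr (_ * _); rewrite /mark.
case: ifP => ar; last first.
  rewrite big_seq big1// => x xr; case: eqP => [ax|_]; last by rewrite expr0.
  by rewrite ax xr in ar.
rewrite (bigD1_seq a)//= eqxx expr1 big1 ?mulr1// => x /negPf xa.
by rewrite eq_sym xa expr0.
Qed.

Variables (m : nat) (e : R).
Hypotheses (m0 : (0 < m)%N)
  (kuzmin_e : forall s, 0 <= s <= 1 -> `|kuzmin M m s - c| <= e).
Hypothesis (mlo : 2 * m%:R * (2 / lo%:R ^+ 2) <= 1 :> R).

(** Marking the single value x with weight z gives a loss close to [delta1 x] times (1 + s). *)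
Definition delta1 (x : nat) : R := (1 - z) / x%:R ^+ 2.
(** The error of [iter_wtrans_exp] with at most two marked values above [lo]: delta <= 2 / lo^2 and
    eta = 2 * 10 / lo^3. *)
Definition mom_err : R := 4 * m%:R * (2 / lo%:R ^+ 2)
  + n%:R * (2 / lo%:R ^+ 2 * e + 2 * (20 / lo%:R ^+ 3)
            + 12 * (m%:R * (2 / lo%:R ^+ 2) ^+ 2)).

Lemma delta1_bounds x : (lo < x)%N -> 0 <= delta1 x <= (lo%:R ^+ 2)^-1.
Proof.
move=> lx; have lo1 := @ler1_nat R lo lo0.
have xl : lo%:R <= x%:R :> R by rewrite ler_nat ltnW.
have /andP[z0 z1] := z01; rewrite /delta1 divr_ge0 ?exprn_ge0//; try lra.
rewrite -[leRHS]mul1r ler_pM ?invr_ge0 ?exprn_ge0//; try lra.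
by rewrite lef_pV2 ?posrE ?exprn_gt0 ?lerXn2r ?nnegrE//; lra.
Qed.

Lemma expect_mark r : uniq r -> {in r, forall a, (lo < a <= hi)%N} ->
  (size r <= 2)%N ->
  `|expect n (fun l => \prod_(x <- r) z ^+ count_mem x l) [::]
    - expR (- (c * (\sum_(x <- r) delta1 x) * n%:R))| <= mom_err.
Proof.
move=> ur rb r2; rewrite -(eq_expect _ _ _ _ (fun l => prod_mark r l ur)).
rewrite expect_prod big_nil mul1r /=.
have lo1 := @ler1_nat R lo lo0; have /andP[z0 z1] := z01.
have size2 (k : R) (f : nat -> R) : 0 <= k -> {in r, forall x, f x <= k} ->
    \sum_(x <- r) f x <= 2 * k.
  move=> k0 fk; apply: (@le_trans _ _ (\sum_(x <- r) k)).
    by rewrite big_seq [leRHS]big_seq; apply: ler_sum => x /fk.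
  rewrite big_const_seq count_predT iter_addr_0 -[leLHS]mulr_natl.
  by rewrite ler_wpM2r// (ler_nat _ _ 2).
set delta := \sum_(x <- r) delta1 x.
have delta0 : 0 <= delta.
  rewrite /delta big_seq; apply: sumr_ge0 => x /rb /andP[lx _].
  by have /andP[] := delta1_bounds x lx.
have delta2 : delta <= 2 / lo%:R ^+ 2.
  apply: size2 => [|x /rb /andP[lx _]]; first by rewrite invr_ge0 exprn_ge0.
  by have /andP[] := delta1_bounds x lx.
set eta := 20 / lo%:R ^+ 3 : R.
have wl s : 0 <= s <= 1 -> `|wloss M (mark r) s - delta * (1 + s)| <= eta.
  move=> s01; rewrite wloss_mark// /delta mulr_suml -sumrB.
  rewrite (le_trans (ler_norm_sum _ _ _))//.
  rewrite /eta (_ : 20 / _ = 2 * (10 * (lo%:R ^+ 3)^-1)); last by ring.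
  apply: size2 => [|x /rb /andP[lx xh]].
    by rewrite mulr_ge0// invr_ge0 exprn_ge0.
  have x0 : (0 < x <= M)%N by rewrite (leq_trans lo0 (ltnW lx)) (leq_trans xh).
  rewrite /delta1 (_ : _ - _ =
    (1 - z) * (pdig x s - (x%:R ^+ 2)^-1 * (1 + s))); last by ring.
  rewrite normrM ger0_norm ?subr_ge0// -[leRHS]mul1r ler_pM ?subr_ge0//.
    by lra.
  apply: le_trans (pdig_approx _ _ x0 s01) _; rewrite ler_wpM2l//.
  have xl : lo%:R <= x%:R :> R by rewrite ler_nat ltnW.
  by rewrite lef_pV2 ?posrE ?exprn_gt0 ?lerXn2r ?nnegrE//; lra.
have md : 2 * m%:R * delta <= 1.
  by apply: le_trans mlo; rewrite ler_wpM2l// mulr_ge0.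
have s0 : 0 <= state [::] <= 1 by rewrite /state/= lexx ler01.
have e0 : 0 <= e by apply: le_trans (normr_ge0 _) (kuzmin_e _ s0).
have := iter_wtrans_exp M _ (mark01 r) m _ _ _ m0 delta0 md wl kuzmin_e n _ s0.
move=> /le_trans; apply; rewrite /mom_err -/eta.
rewrite lerD ?ler_wpM2l ?mulr_ge0//.
rewrite lerD ?lerD ?ler_wpM2r ?ler_wpM2l//.
  by rewrite /eta divr_ge0 ?exprn_ge0.
by rewrite lerXn2r ?nnegrE// (le_trans delta0).
Qed.

Definition expect_occ (x : nat) : R := expR (- (c * delta1 x * n%:R)).

Lemma expect_occ_bounds x : 0 <= expect_occ x <= 1.
Proof.
have /andP[z0 z1] := z01.
rewrite expR_ge0 -expR0 ler_expR oppr_le0 !mulr_ge0 ?subr_ge0//.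
by rewrite invr_ge0; have := @ln2_ge R; lra.
Qed.

Let D x (l : seq nat) : R := z ^+ count_mem x l - expect_occ x.

(** For distinct values the exponential turns the sum of the two [delta1] into a product, so the
    covariance is made of three moment errors. On the diagonal the square is at most 1. *)
Lemma expect_DD x y : (lo < x <= hi)%N -> (lo < y <= hi)%N ->
  expect n (fun l => D x l * D y l) [::] <= 3 * mom_err + (x == y)%:R.
Proof.
move=> xb yb; have /andP[z0 z1] := z01.
have /andP[ex0 ex1] := expect_occ_bounds x.
have /andP[ey0 ey1] := expect_occ_bounds y.
have E1 u : (lo < u <= hi)%N ->
    `|expect n (fun l => z ^+ count_mem u l) [::] - expect_occ u| <= mom_err.
  move=> ub; have := expect_mark [:: u].
  rewrite big_seq1; under eq_expect do rewrite big_seq1; apply => //.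
  by move=> a; rewrite inE => /eqP ->.
have err0 : 0 <= mom_err by apply: le_trans (normr_ge0 _) (E1 x xb).
have [xy|xy] := eqVneq x y.
  rewrite -(expect_cst n (3 * mom_err + 1) [::])//; apply: ler_expect => // l _.
  rewrite -xy -expr2 ler_wpDl ?mulr_ge0//.
  have := exprn_ile1 (count_mem x l) z0 z1.
  have := exprn_ge0 (count_mem x l) z0.
  by rewrite /D; move: (z ^+ _) => v; nra.
rewrite addr0.
have EE : `|expect n (fun l => z ^+ count_mem x l * z ^+ count_mem y l) [::]
    - expect_occ x * expect_occ y| <= mom_err.
  have := expect_mark [:: x; y].
  rewrite big_cons big_seq1 mulrDr mulrDl opprD expRD.
  under eq_expect do rewrite big_cons big_seq1; apply => //=.
    by rewrite inE xy.
  by move=> a; rewrite !inE => /orP[] /eqP ->.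
have -> : expect n (fun l => D x l * D y l) [::] =
    expect n (fun l => z ^+ count_mem x l * z ^+ count_mem y l) [::]
    + (- expect_occ x) * expect n (fun l => z ^+ count_mem y l) [::]
    + (- expect_occ y) * expect n (fun l => z ^+ count_mem x l) [::]
    + expect_occ x * expect_occ y.
  rewrite -!expectZ -!expectD -[X in _ + X](expect_cst n _ [::])// -expectD.
  by apply: eq_expect => l; rewrite /D; ring.
have Ex := E1 x xb; have Ey := E1 y yb; move: EE Ex Ey; rewrite !ler_norml.
move: (expect _ _ _) (expect _ _ _) (expect _ _ _) => exy Ex Ey.
move: (expect_occ x) (expect_occ y) ex0 ex1 ey0 ey1 => ex ey *.
nra.
Qed.

Definition Wmid l : R := \sum_(lo.+1 <= x < hi.+1) (1 - z ^+ count_mem x l).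
Definition Wmean : R := \sum_(lo.+1 <= x < hi.+1) (1 - expect_occ x).

Lemma Wmid_var : expect n (fun l => (Wmid l - Wmean) ^+ 2) [::]
  <= 3 * hi%:R ^+ 2 * mom_err + hi%:R.
Proof.
rewrite (eq_expect _ _ (fun l => \sum_(lo.+1 <= x < hi.+1)
    \sum_(lo.+1 <= y < hi.+1) D x l * D y l)); last first.
  move=> l; rewrite expr2 (_ : Wmid l - Wmean = - \sum_(lo.+1 <= x < hi.+1) D x l).
    by rewrite mulrNN mulr_suml; apply: eq_bigr => x _; rewrite mulr_sumr.
  by rewrite /Wmid /Wmean -sumrB -sumrN; apply: eq_bigr => x _; rewrite /D; ring.
rewrite expect_sum; under eq_bigr do rewrite expect_sum.
have err0 : 0 <= mom_err.
  have s0 : 0 <= (0 : R) <= 1 by rewrite lexx ler01.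
  have e0 : 0 <= e by apply: le_trans (normr_ge0 _) (kuzmin_e _ s0).
  by rewrite /mom_err !(addr_ge0, mulr_ge0, divr_ge0, exprn_ge0).
apply: (@le_trans _ _ (\sum_(lo.+1 <= x < hi.+1) (3 * hi%:R * mom_err + 1))).
  rewrite big_nat_cond [leRHS]big_nat_cond; apply: ler_sum => x.
  rewrite andbT ltnS => xb.
  apply: (@le_trans _ _ (\sum_(lo.+1 <= y < hi.+1) (3 * mom_err + (x == y)%:R))).
    rewrite big_nat_cond [leRHS]big_nat_cond; apply: ler_sum => y.
    by rewrite andbT ltnS => yb; exact: expect_DD.
  rewrite big_split/= lerD//.
    rewrite sumr_const_nat subSS -[leLHS]mulr_natl mulrCA mulrA ler_wpM2r//.
    by rewrite ler_wpM2l// ler_nat leq_subr.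
  rewrite (bigD1_seq x) ?iota_uniq ?mem_index_iota ?ltnS//= eqxx big1 ?addr0//.
  by move=> y /negPf yx; rewrite eq_sym yx.
rewrite sumr_const_nat subSS -[leLHS]mulr_natl.
apply: (@le_trans _ _ (hi%:R * (3 * hi%:R * mom_err + 1))).
  rewrite ler_wpM2r ?ler_nat ?leq_subr//.
  by rewrite addr_ge0 ?mulr_ge0.
by rewrite le_eqVlt; apply/orP; left; apply/eqP; ring.
Qed.

End moments.

Definition tail_count hi (l : seq nat) : R := (count (fun a => hi < a)%N l)%:R.

(** Whatever the state, a new digit exceeds [hi] with probability (1 + s) / (hi + 1 + s), at most 2
    / (hi + 1). *)
Lemma expect_tail_count hi n l : (hi <= M)%N -> digits_pos l ->
  expect n (tail_count hi) l <= tail_count hi l + n%:R * (2 / hi.+1%:R).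
Proof.
move=> hM; elim: n l => [|n IH] l lp /=; first by rewrite mul0r addr0.
have s01 := state_itv l lp.
set k := 2 / hi.+1%:R : R.
apply: (@le_trans _ _ (\sum_(1 <= a < M.+2) (pdig a (state l) * (tail_count hi l + n%:R * k)
   + (if (hi < a)%N then pdig a (state l) else 0)))).
  rewrite big_nat_cond [leRHS]big_nat_cond; apply: ler_sum => a.
  rewrite andbT => /andP[a1 _].
  have alp : digits_pos (a :: l) by rewrite /= a1.
  apply: le_trans (ler_wpM2l (pdig_ge0 M _ _ a1 s01) (IH _ alp)) _.
  have -> : tail_count hi (a :: l) = (hi < a)%N%:R + tail_count hi l.
    by rewrite /tail_count -natrD.
  by rewrite le_eqVlt /k; apply/orP; left; apply/eqP; case: (hi < a)%N => /=; ring.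
rewrite big_split/= -mulr_suml sum_pdig// mul1r -natr1 mulrDl mul1r addrA lerD2l.
rewrite (big_cat_nat (n := hi.+1))//=; last by rewrite ltnS leqW.
rewrite [X in X + _ <= _]big1_seq ?add0r; last first.
  move=> a /=; rewrite mem_index_iota ltnS => /andP[_ ah].
  by rewrite ltnNge ah.
rewrite (eq_big_nat _ _ (F2 := fun a => pdig a (state l))); last first.
  by move=> a /andP[-> _].
have /andP[s0 s1] := s01.
rewrite sum_pdig_from// /k ler_pM ?invr_ge0 ?addr_ge0//; first lra.
by rewrite lef_pV2 ?posrE ?ltr_wpDr// lerDl.
Qed.

Definition exceptional z lo hi n (thr : R) l : bool :=
  (thr <= `|Wmid z lo hi l - Wmean z lo hi n|) || (thr <= tail_count hi l).

(** Chebyshev's inequality for [Wmid] and Markov's inequality for [tail_count]. *)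
Lemma expect_exceptional z lo hi n m e thr :
  0 <= z <= 1 -> (0 < lo)%N -> (hi <= M)%N -> (0 < m)%N ->
  (forall s, 0 <= s <= 1 -> `|kuzmin M m s - (ln 2)^-1| <= e) ->
  2 * m%:R * (2 / lo%:R ^+ 2) <= 1 :> R -> 0 < thr ->
  expect n (fun l => (exceptional z lo hi n thr l)%:R) [::] <=
  (3 * hi%:R ^+ 2 * mom_err lo n m e + hi%:R) / thr ^+ 2
  + n%:R * (2 / hi.+1%:R) / thr.
Proof.
move=> z01 lo0 hiM m0 kz mlo thr0.
apply: (@le_trans _ _ (expect n (fun l => (thr ^+ 2)^-1 * (Wmid z lo hi l -
  Wmean z lo hi n) ^+ 2 + thr^-1 * tail_count hi l) [::])).
  apply: ler_expect => // l _; rewrite /exceptional.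
  have t2 : 0 < thr ^+ 2 by rewrite exprn_gt0.
  have T0 : 0 <= thr^-1 * tail_count hi l by rewrite mulr_ge0// invr_ge0 ltW.
  have V0 : 0 <= (thr ^+ 2)^-1 * (Wmid z lo hi l - Wmean z lo hi n) ^+ 2.
    by rewrite mulr_ge0 ?sqr_ge0// invr_ge0 ltW.
  case: (leP thr `|_|) => [h1|_] /=; last case: (leP thr _) => [h2|_] /=.
  - rewrite ler_wpDr// mulrC ler_pdivlMr// mul1r -[leRHS]real_normK ?num_real//.
    by rewrite lerXn2r ?nnegrE// ltW.
  - by rewrite ler_wpDl// mulrC ler_pdivlMr// mul1r.
  - by rewrite addr_ge0.
rewrite expectD !expectZ lerD//.
  rewrite mulrC ler_wpM2r ?invr_ge0 ?exprn_ge0 ?(ltW thr0)//.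
  exact: Wmid_var.
rewrite mulrC ler_wpM2r ?invr_ge0 ?(ltW thr0)//.
have := expect_tail_count hi n [::] hiM isT.
by rewrite [X in X + _]/tail_count /= add0r.
Qed.
End digit_expectation.

(** (7/8)^j <= exp (- x / 8), which is the 12th power of exp (- x / 96) <= 96 / x. *)
Lemma geom_poly_bound {R : realType} (x : R) (j : nat) : x = j%:R -> 0 < x ->
  (7 / 8) ^+ j <= 96 ^+ 12 / x ^+ 12.
Proof.
move=> xj x0; have x960 : 0 < 1 + x / 96 by lra.
have -> : 96 ^+ 12 / x ^+ 12 = (x / 96) ^- 12 by rewrite expr_div_n invf_div.
apply: (@le_trans _ _ (expR (- (x / 96)) ^+ 12)).
  rewrite -expRM_natr (_ : - (x / 96) * 12%:R = - (1 / 8) * j%:R); last by rewrite -xj; field.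
  rewrite expRM_natr lerXn2r ?nnegrE ?expR_ge0//.
  by have := expR_ge1Dx (- (1 / 8) : R); lra.
have x96 : 0 < x / 96 by rewrite divr_gt0.
rewrite -exprVn lerXn2r ?nnegrE ?expR_ge0 ?invr_ge0 ?(ltW x96)//.
rewrite expRN lef_pV2 ?posrE ?expR_gt0//.
by have := expR_ge1Dx (x / 96); lra.
Qed.

Section exceptional_probability.
Context {R : realType}.

(* For n = j ^ 32, so that sqrt n = j ^ 16: the values up to j ^ 15 are few,
   those above j ^ 19 are seldom hit, and deviations larger than j ^ 15, still
   o(sqrt n), have summable probability O(1 / j ^ 2). *)
Definition block_exceptional (z : R) j : seq nat -> bool :=
  exceptional z (j ^ 15) (j ^ 19) (j ^ 32) (j%:R ^+ 15).

(** The alphabet is cut at M = j^40 and the corrector at m = j terms. The added summand anticipates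
    the measure of points having a digit above M among the first n. *)
Lemma block_exceptional_prob : exists C : R, forall (z : R) j, 0 <= z <= 1 -> (2 <= j)%N ->
  expect (j ^ 40) (j ^ 32) (fun l => (block_exceptional z j l)%:R) [::]
  + (j ^ 32)%:R * (2 / (j ^ 40).+1%:R) <= C / j%:R ^+ 2.
Proof.
(* One constant for each of the seven terms into which the bound is expanded below. *)
exists (24 + 6 * (96 ^+ 12 + 4) + 120 + 144 + 1 + 2 + 2) => z j z01 j2.
have j0 : (0 < j)%N by exact: ltnW.
set x : R := j%:R; have x2 : 2 <= x by rewrite (ler_nat _ 2).
have x0 : 0 < x by lra.
have y0 : 0 < x^-1 by rewrite invr_gt0.
have y1 : x^-1 <= 1 by rewrite invf_le1//; lra.
have xy : x * x^-1 = 1 by rewrite divff ?lt0r_neq0.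
have yX (k : nat) : (2 <= k)%N -> (x ^+ k)^-1 <= (x ^+ 2)^-1.
  by move=> k2; rewrite lef_pV2 ?posrE ?exprn_gt0// ler_weXn2l//; lra.
have succ_le (k : nat) : 2 / (j ^ k).+1%:R <= 2 / x ^+ k.
  by rewrite ler_wpM2l// lef_pV2 ?posrE ?exprn_gt0// -natrX ler_nat.
pose e : R := (96 ^+ 12 + 4) / x ^+ 12.
have kz s : 0 <= s <= 1 -> `|kuzmin (j ^ 40) j s - (ln 2)^-1| <= e.
  move=> s01; apply: le_trans (kuzmin_limit (j ^ 40) j s _ s01) _.
    by rewrite expn_gt0 j0.
  rewrite [leRHS]mulrDl lerD ?geom_poly_bound// -/x -mulrA ler_wpM2l//.
  apply: (@le_trans _ _ (x / x ^+ 40)).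
    rewrite ler_wpM2l ?(ltW x0)// lef_pV2 ?posrE ?exprn_gt0//.
    by rewrite -natrX ler_nat.
  rewrite (exprS _ 39) invfM mulrA divff ?lt0r_neq0// mul1r.
  by rewrite lef_pV2 ?posrE ?exprn_gt0// ler_weXn2l//; lra.
have mlo : 2 * j%:R * (2 / (j ^ 15)%:R ^+ 2) <= 1 :> R.
  rewrite natrX -/x -exprM (_ : 2 * x * _ = 4 * (x ^+ 29)^-1); last first.
    by rewrite (exprS _ 29); field; rewrite ?expf_neq0// lt0r_neq0.
  apply: (@le_trans _ _ (4 * (x ^+ 2)^-1)); first by rewrite ler_wpM2l// yX.
  by rewrite ler_pdivrMr ?exprn_gt0//; nra.
have thr0 : 0 < x ^+ 15 by rewrite exprn_gt0.
have := expect_exceptional (j ^ 40) z (j ^ 15) (j ^ 19) (j ^ 32) j e (x ^+ 15) z01.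
case/(_ _ _ j0 kz mlo thr0)/(fun x => conj x I) => [||[main _]].
- by rewrite expn_gt0 j0.
- by rewrite leq_exp2l.
apply: le_trans (lerD main (lexx _)) _.
rewrite /mom_err !natrX -/x.
have e0 : 0 <= e by rewrite /e divr_ge0 ?addr_ge0 ?exprn_ge0//; lra.
apply: (@le_trans _ _ ((3 * (x ^+ 19) ^+ 2 * (4 * x * (2 / x ^+ 15 ^+ 2) +
  x ^+ 32 * (2 / x ^+ 15 ^+ 2 * e + 2 * (20 / x ^+ 15 ^+ 3) +
   12 * (x * (2 / x ^+ 15 ^+ 2) ^+ 2))) + x ^+ 19) / x ^+ 15 ^+ 2
   + x ^+ 32 * (2 / x ^+ 19) / x ^+ 15 + x ^+ 32 * (2 / x ^+ 40))).
  apply: lerD; last by rewrite ler_wpM2l ?exprn_ge0 ?(ltW x0).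
  apply: lerD => //; rewrite ler_wpM2r ?invr_ge0 ?exprn_ge0 ?(ltW x0)//.
  by rewrite ler_wpM2l ?exprn_ge0 ?(ltW x0).
have q (k : R) a b d : (2 <= d)%N -> (a + d = b)%N -> 0 <= k ->
    k * x ^+ a / x ^+ b <= k / x ^+ 2.
  move=> d2 <- k0; rewrite -mulrA exprD invfM mulVKf ?lt0r_neq0 ?exprn_gt0//.
  by rewrite ler_wpM2l// yX.
have split (H b1 nn b2 b3 b4 h t : R) :
    (3 * H * (b1 + nn * (b2 + b3 + b4)) + h) / t =
    3 * H * b1 / t + 3 * H * (nn * b2) / t + 3 * H * (nn * b3) / t
    + 3 * H * (nn * b4) / t + h / t by ring.
have K0 : 0 <= 96 ^+ 12 + 4 :> R by rewrite addr_ge0 ?exprn_ge0.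
rewrite split /e; move: (96 ^+ 12 + 4 : R) K0 => K K0.
rewrite [leRHS](_ : _ = 24 / x ^+ 2 + 6 * K / x ^+ 2 + 120 / x ^+ 2 + 144 / x ^+ 2
  + 1 / x ^+ 2 + 2 / x ^+ 2 + 2 / x ^+ 2); last by move: (_^-1) => i; ring.
have XD a b : x ^+ (a + b) = x ^+ a * x ^+ b by exact: exprD.
have VD a b : (x ^+ (a + b))^-1 = (x ^+ a)^-1 * (x ^+ b)^-1 by rewrite exprD invfM.
rewrite -!exprM -![(19 * 2)%N]/38%N -![(15 * 2)%N]/30%N -![(15 * 3)%N]/45%N.
(* Each term is a constant times x^a / x^b with b - a >= 2. Equality holds for the term in [e],
   which is why [e] has order x^-12, and for the digits above j^19. *)
do 6 ?[apply: lerD].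
- apply: le_trans (q 24 39%N 60%N 21%N isT erefl _) => //.
  rewrite le_eqVlt; apply/orP; left; apply/eqP.
  by rewrite (XD 38%N 1%N) (VD 30%N 30%N) expr1;
    move: (x ^+ 38) (x ^+ 30)^-1; clear => *; ring.
- apply: le_trans (q (6 * K) 70%N 72%N 2%N isT erefl _) => //; last by rewrite mulr_ge0.
  rewrite le_eqVlt; apply/orP; left; apply/eqP.
  by rewrite (XD 38%N 32%N) (VD 60%N 12%N) (VD 30%N 30%N);
    move: (x ^+ 38) (x ^+ 32) (x ^+ 30)^-1 (x ^+ 12)^-1; clear => *; ring.
- apply: le_trans (q 120 70%N 75%N 5%N isT erefl _) => //.
  rewrite le_eqVlt; apply/orP; left; apply/eqP.
  by rewrite (XD 38%N 32%N) (VD 45%N 30%N);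
    move: (x ^+ 38) (x ^+ 32) (x ^+ 30)^-1 (x ^+ 45)^-1; clear => *; ring.
- apply: le_trans (q 144 71%N 90%N 19%N isT erefl _) => //.
  rewrite le_eqVlt; apply/orP; left; apply/eqP.
  by rewrite (XD 70%N 1%N) (XD 38%N 32%N) (VD 60%N 30%N) (VD 30%N 30%N) expr1;
    move: (x ^+ 38) (x ^+ 32) (x ^+ 30)^-1; clear => *; ring.
- by apply: le_trans (q 1 19%N 30%N 11%N isT erefl _) => //; rewrite mul1r.
- apply: le_trans (q 2 32%N 34%N 2%N isT erefl _) => //.
  rewrite le_eqVlt; apply/orP; left; apply/eqP.
  by rewrite (VD 19%N 15%N);
    move: (x ^+ 32) (x ^+ 19)^-1 (x ^+ 15)^-1; clear => *; ring.
- apply: le_trans (q 2 32%N 40%N 8%N isT erefl _) => //.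
  by rewrite mulrCA mulrA.
Qed.
End exceptional_probability.

(** * Cylinders and Lebesgue measure *)

Section cylinders.
Context {R : realType}.
Implicit Types (l : seq nat) (t u v : R).

(* [cyl_map l t] is the point whose expansion starts with the digits of l
   (last letter first) and continues with that of t. *)
Fixpoint cyl_map l t : R := if l is a :: l' then cyl_map l' (step a t) else t.

(** The product of the transition probabilities of the chain without merging, which is the length of
    the cylinder of l. *)
Fixpoint cyl_len l : R := if l is a :: l' then
  cyl_len l' * ((1 + state l') / ((a%:R + state l') * (a.+1%:R + state l')))
  else 1.

(* The distribution function of the Gauss orbit point T^m w given the first m
   digits, where s = [a_m, ..., a_1]. *)
Definition cond_cdf (s t : R) : R := (1 + s) * t / (1 + s * t).

Lemma cond_cdf_step a (s u v : R) : (0 < a)%N -> 0 <= s <= 1 -> 0 <= u <= 1 ->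
  0 <= v <= 1 ->
  cond_cdf s (step a u) - cond_cdf s (step a v) =
  (1 + s) / ((a%:R + s) * (a.+1%:R + s))
  * (cond_cdf (step a s) v - cond_cdf (step a s) u).
Proof.
move=> /(@ler1_nat R) a1 s01 u01 v01; rewrite /cond_cdf /step -natr1.
have su : 0 <= s * u by rewrite mulr_ge0; lra.
field; rewrite !lt0r_neq0//; try lra.
all: rewrite ?addr_gt0 ?mulr_gt0//; lra.
Qed.

Lemma cyl_len_ge0 l : digits_pos l -> 0 <= cyl_len l.
Proof.
elim: l => //= a l IH /andP[a1 lp]; have /andP[s0 _] := @state_itv R l lp.
by rewrite mulr_ge0 ?IH// divr_ge0 ?mulr_ge0 ?addr_ge0.
Qed.

(** By [cond_cdf_step], each inverse branch transports the conditional distribution function to that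
    of the next state, scaled by the probability of the letter; it also reverses orientation, hence
    the absolute values. *)
Lemma cyl_map_dist l u v : digits_pos l -> 0 <= u <= 1 -> 0 <= v <= 1 ->
  `|cyl_map l u - cyl_map l v| =
  cyl_len l * `|cond_cdf (state l) u - cond_cdf (state l) v|.
Proof.
elim: l u v => [|a l IH] u v.
  by rewrite /cond_cdf /state/= !mul0r !addr0 !divr1 !mul1r.
move=> /= /andP[a1 lp] u01 v01; rewrite IH ?step_itv//.
have s01 := @state_itv R l lp; have /andP[s0 _] := s01.
rewrite cond_cdf_step// normrM -mulrA distrC; congr (_ * (_ * _)).
by rewrite ger0_norm// divr_ge0 ?mulr_ge0 ?addr_ge0.
Qed.

(** [cyl_map l] is monotone, in a direction that changes with each letter; the minimum and maximum
    avoid following the parity. *)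
Lemma cyl_map_itv l t u v : digits_pos l -> 0 <= u -> u <= t <= v -> v <= 1 ->
  Num.min (cyl_map l u) (cyl_map l v) <= cyl_map l t
  <= Num.max (cyl_map l u) (cyl_map l v).
Proof.
elim: l t u v => [|a l IH] t u v /=.
  by move=> _ _ /andP[ut tv] _; rewrite ge_min ut le_max tv orbT.
move=> /andP[a1 lp] u0 /andP[ut tv] v1; rewrite minC maxC.
have u01 : 0 <= u <= 1 by rewrite u0 (le_trans ut)// (le_trans tv).
have v01 : 0 <= v <= 1 by rewrite v1 (le_trans u0)// (le_trans ut).
have /andP[_ su1] := step_itv a u a1 u01.
have /andP[sv0 _] := step_itv a v a1 v01.
apply: IH => //; have a1R := @ler1_nat R a a1.
by rewrite /step !lef_pV2 ?posrE; lra.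
Qed.

Definition cyl_seg l t : set (measurableTypeR R) :=
  [set` `[Num.min (cyl_map l 0) (cyl_map l t), Num.max (cyl_map l 0) (cyl_map l t)]].

Lemma measurable_cyl_seg l t : measurable (cyl_seg l t).
Proof. exact: measurable_itv. Qed.

Lemma cyl_seg_measure l t : digits_pos l -> 0 <= t <= 1 ->
  (lebesgue_measure (cyl_seg l t) <= (cyl_len l * cond_cdf (state l) t)%:E)%E.
Proof.
move=> lp t01; have /andP[s0 _] := @state_itv R l lp; have /andP[t0 _] := t01.
have F0 : 0 <= cond_cdf (state l) t.
  by rewrite divr_ge0 ?mulr_ge0 ?addr_ge0 ?mulr_ge0.
rewrite lebesgue_measure_itv/= lte_fin.
case: ifP => _; last by rewrite lee_fin mulr_ge0 ?cyl_len_ge0.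
rewrite -EFinB lee_fin.
have -> : Num.max (cyl_map l 0) (cyl_map l t) - Num.min (cyl_map l 0) (cyl_map l t)
    = `|cyl_map l t - cyl_map l 0|.
  by case: (leP (cyl_map l 0) (cyl_map l t)) => h; [rewrite ger0_norm ?subr_ge0|
    rewrite ltr0_norm ?subr_lt0// opprB].
rewrite cyl_map_dist//; last by rewrite lexx ler01.
by rewrite [cond_cdf _ 0]/cond_cdf mulr0 mul0r subr0 ger0_norm.
Qed.

Variable M : nat.

(* A union of segments covering every irrational point whose word of n further
   digits after l is in B, together with all points having a digit above M. *)
Fixpoint cover n (B : seq nat -> bool) l : set (measurableTypeR R) :=
  if n is k.+1 then
    cyl_seg l (M.+1%:R^-1) `|` \big[setU/set0]_(i < M) cover k B (i.+1 :: l)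
  else if B l then cyl_seg l 1 else set0.

Lemma measurable_cover n B l : measurable (cover n B l).
Proof.
elim: n l => [|n IH] l /=; first by case: (B l); [exact: measurable_cyl_seg|].
apply: measurableU; first exact: measurable_cyl_seg.
by apply: bigsetU_measurable => i _; exact: IH.
Qed.

(** The recursion of [cover] follows that of [expect] on the letters up to M, and each level adds
    one segment of relative length at most 2 / (M + 1). *)
Lemma cover_measure n B l : digits_pos l ->
  (lebesgue_measure (cover n B l) <= (cyl_len l *
     (expect M n (fun l' => (B l')%:R) l + n%:R * (2 / M.+1%:R)))%:E)%E.
Proof.
elim: n l => [|n IH] l lp; have w0 := cyl_len_ge0 l lp;
  have s01 := @state_itv R l lp; have /andP[s0 _] := s01.
  rewrite /= mul0r addr0; case: (B l); last by rewrite mulr0 measure0.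
  apply: le_trans (cyl_seg_measure l 1 lp _) _; first by rewrite ler01 lexx.
  by rewrite /cond_cdf !mulr1 divff ?mulr1// lt0r_neq0// ltr_pwDl.
rewrite [cover _ _ _]/=; apply: le_trans (measureU2 _ _ _) _.
- exact: measurable_cyl_seg.
- by apply: bigsetU_measurable => i _; exact: measurable_cover.
set k : R := 2 / M.+1%:R; have k0 : 0 <= k by rewrite /k divr_ge0.
have iM : 0 <= (M.+1%:R^-1 : R) <= 1 by rewrite invr_ge0 ler0n invf_le1 ?ler1n.
pose E a : R := expect M n (fun l' => (B l')%:R) (a :: l).
have sum_le : (lebesgue_measure (\big[setU/set0]_(i < M) cover n B (i.+1 :: l)) <=
    (cyl_len l * (\sum_(1 <= a < M.+1) pdig M a (state l) * (E a + n%:R * k)))%:E)%E.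
  have := @Boole_inequality _ _ _ (@lebesgue_measure R)
    (fun i => cover n B (i.+1 :: l)) M (fun i _ => measurable_cover n B (i.+1 :: l)).
  move=> /le_trans; apply.
  rewrite mulr_sumr big_add1 big_mkord -sumEFin; apply: lee_sum => i _.
  apply: le_trans (IH _ _) _; first by rewrite /= lp.
  by rewrite lee_fin /= pdig_lt//= [leRHS]mulrA.
apply: le_trans (leeD (cyl_seg_measure l _ lp iM) sum_le) _.
rewrite -EFinD lee_fin -mulrDr ler_wpM2l//.
rewrite [expect _ _ _ _]/= [X in _ <= X + _]big_nat_recr//= -/(E _).
(* A next digit above M means an orbit point below 1 / (M + 1), up to endpoints: the segment has the
   probability of the merged letter. *)
have -> : cond_cdf (state l) M.+1%:R^-1 = pdig M M.+1 (state l).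
  rewrite pdig_last /cond_cdf; field.
  by rewrite lt0r_neq0 ?ltr_pwDl//= lt0r_neq0// ltr0Sn.
have pk : pdig M M.+1 (state l) <= k by exact: pdig_last_le M _ s01.
have p0 : 0 <= pdig M M.+1 (state l : R) by exact: pdig_ge0.
have E0 : 0 <= E M.+1.
  rewrite -(expect_cst M n 0 (M.+1 :: l)) ?/digits_pos/= ?lp//.
  by apply: ler_expect => //=.
under eq_bigr do rewrite mulrDr.
rewrite big_split/= -mulr_suml.
have := sum_pdig M (state l) s01; rewrite big_nat_recr//= => S1.
have nk0 : 0 <= n%:R * k by rewrite mulr_ge0.
have pE := mulr_ge0 p0 E0.
have S2 : \sum_(1 <= a < M.+1) pdig M a (state l : R) <= 1.
  by rewrite -S1 lerDl.
have S3 := ler_wpM2r nk0 S2.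
rewrite -(natr1 n) [(_ + 1) * k]mulrDl mul1r; rewrite mul1r in S3.
rewrite -[X in _ <= X + _ + _]/(\sum_(1 <= a < M.+1) pdig M a (state l) * E a).
move: (\sum_(1 <= a < M.+1) pdig M a (state l) * E a) => S; move: pE pk S3.
by move: (pdig M M.+1 _) (n%:R * k) (pdig M M.+1 _ * _) ((\sum_(_ <= _ < _) _) * _) => *; lra.
Qed.

End cylinders.

(** * Orbits of the Gauss map and nonterminating expansions *)

Section gauss_orbit.
Context {R : realType}.
Implicit Types (w : R).

Definition rev_prefix w n : seq nat := rev (cf_prefix w n).

Lemma rev_prefixS w n : rev_prefix w n.+1 = cf_digit w n :: rev_prefix w n.
Proof. by rewrite /rev_prefix /cf_prefix -addn1 iotaD map_cat cats1 rev_rcons. Qed.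

Lemma gauss_digit w i : 0 < iter i gauss w < 1 ->
  [/\ (0 < cf_digit w i)%N, 0 <= iter i.+1 gauss w < 1
   & iter i gauss w = step (cf_digit w i) (iter i.+1 gauss w)].
Proof.
rewrite /cf_digit iterS; set x := iter i gauss w => /andP[x0 x1].
have V0 : 0 <= x^-1 by rewrite invr_ge0 ltW.
have V1 : 1 < x^-1 by rewrite invf_gt1.
have fE : (Num.floor x^-1)%:~R = (Num.truncn x^-1)%:R :> R.
  by rewrite truncn_floor V0 natr_absz ger0_norm// floor_ge0.
have /andP[t0 t1] := truncn_itv V0.
rewrite /gauss fE; split.
- by rewrite -(ltr0n R); move: t1; rewrite -natr1; lra.
- by move: t1; rewrite -natr1; lra.
- by rewrite /step addrC subrK invrK.
Qed.

Definition nonterminating w := forall i, iter i gauss w != 0.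

Lemma gauss_orbit_itv w i : 0 < w < 1 -> nonterminating w ->
  0 < iter i gauss w < 1.
Proof.
move=> w01 nt; elim: i => [//|i IH].
have [_ /andP[g0 g1] _] := gauss_digit _ _ IH.
by rewrite g1 andbT lt_neqAle eq_sym nt.
Qed.

Lemma rev_prefix_pos w i : 0 < w < 1 -> nonterminating w -> digits_pos (rev_prefix w i).
Proof.
move=> w01 nt; elim: i => [//|i IH]; rewrite rev_prefixS /= IH andbT.
by have [] := gauss_digit _ _ (gauss_orbit_itv _ i w01 nt).
Qed.

Lemma cyl_map_prefix w i : 0 < w < 1 -> nonterminating w ->
  cyl_map (rev_prefix w i) (iter i gauss w) = w.
Proof.
move=> w01 nt; elim: i => [//|i IH]; rewrite rev_prefixS /=.
by have [_ _ <-] := gauss_digit _ _ (gauss_orbit_itv _ i w01 nt).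
Qed.

Lemma cyl_seg_prefix w i (t : R) : 0 < w < 1 -> nonterminating w ->
  iter i gauss w <= t <= 1 -> cyl_seg (rev_prefix w i) t w.
Proof.
move=> w01 nt /andP[it t1]; rewrite /cyl_seg/= in_itv/=.
have /andP[i0 i1] := gauss_orbit_itv _ i w01 nt.
have := cyl_map_itv (rev_prefix w i) (iter i gauss w) 0 t
  (rev_prefix_pos _ i w01 nt) (lexx _).
by rewrite (ltW i0) it cyl_map_prefix//; apply.
Qed.

(** A next digit at most M selects a branch of the union; a larger one puts the orbit point in
    [0, 1 / (M + 1)], hence w in the first segment. *)
Lemma mem_cover M n (B : seq nat -> bool) w i : 0 < w < 1 -> nonterminating w ->
  B (rev_prefix w (i + n)) -> cover M n B (rev_prefix w i) w.
Proof.
move=> w01 nt; elim: n i => [|n IH] i.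
  rewrite addn0 /= => ->; apply: cyl_seg_prefix => //.
  by rewrite lexx andbT; have /andP[_ /ltW] := gauss_orbit_itv _ i w01 nt.
rewrite -addSnnS => /IH; rewrite rev_prefixS /=.
have [d0 /andP[g0 g1] gE] := gauss_digit _ _ (gauss_orbit_itv _ i w01 nt).
have [dM|Md] := leqP (cf_digit w i) M.
  move=> cw; right.
  rewrite -(bigcup_mkord M (fun k => cover M n B (k.+1 :: rev_prefix w i))).
  exists (cf_digit w i).-1 => /=.
    by rewrite prednK.
  by rewrite prednK.
move=> _; left; apply: cyl_seg_prefix => //; rewrite gE /step.
rewrite invf_le1 ?ler1n// andbT lef_pV2 ?posrE//; last by rewrite ltr_pwDl ?ltr0n.
by rewrite (le_trans (_ : _ <= (cf_digit w i)%:R)) ?ler_nat// lerDl.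
Qed.

Lemma terminating_rat w i : iter i gauss w = 0 -> w \in range (@ratr R).
Proof.
elim: i w => [|i IH] w.
  by move=> /= ->; rewrite inE; exists 0 => //; rewrite rmorph0.
rewrite iterSr => /IH; rewrite !inE => -[q _ qE]; exists (q + (Num.floor w^-1)%:~R)^-1 => //.
by rewrite fmorphV rmorphD/= ratr_int qE /gauss subrK invrK.
Qed.

Lemma ae_nonterminating : {ae (@lebesgue_measure R), forall w, nonterminating w}.
Proof.
exists (range (@ratr R)); split.
- apply: countable_measurable; first exact: measurable_set1.
  exact: sub_countable (card_image_le _ _) (countableP _).
- exact: lebesgue_measure_rat.
- move=> w /= nt; rewrite -inE.
  apply: contrapT => nr; apply: nt => i; apply/eqP => /terminating_rat; exact: nr.
Qed.
End gauss_orbit.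

(** * Borel-Cantelli for the exceptional blocks *)

Section almost_everywhere.
Context {R : realType}.

Lemma sum_inv_sqr_le1 n : \sum_(j < n) (j.+2%:R ^+ 2)^-1 <= 1 :> R.
Proof.
suff : \sum_(j < n) (j.+2%:R ^+ 2)^-1 <= 1 - n.+1%:R^-1 :> R.
  by move=> /le_trans; apply; rewrite gerBl.
elim: n => [|n IH]; first by rewrite big_ord0 invr1 subrr.
rewrite big_ord_recr/= (le_trans (lerD IH (lexx _)))//.
have n0 : 0 < n.+1%:R :> R by rewrite ltr0n.
rewrite -(natr1 n.+1); move: (n.+1%:R : R) n0 => x x0.
have -> : 1 - (x + 1)^-1 = 1 - x^-1 + (x * (x + 1))^-1.
  by field; rewrite !lt0r_neq0//; lra.
by rewrite lerD2l lef_pV2 ?posrE; nra.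
Qed.

Lemma ae_not_exceptional (z : R) : 0 <= z <= 1 ->
  {ae (@lebesgue_measure R), forall w : R, 0 < w < 1 ->
    \forall j \near \oo, ~~ block_exceptional z j (rev_prefix w (j ^ 32))}.
Proof.
move=> z01; have [C HC] := @block_exceptional_prob R.
(* The index is shifted by 2 because [block_exceptional_prob] starts at j = 2. *)
pose F j : set (measurableTypeR R) := cover (j.+2 ^ 40) (j.+2 ^ 32) (block_exceptional z j.+2) [::].
have C0 : 0 <= C.
  have [j j2] : exists j, (2 <= j)%N by exists 2%N.
  have j0 : 0 < j%:R ^+ 2 :> R by rewrite exprn_gt0// ltr0n ltnW.
  have := HC z j z01 j2; rewrite ler_pdivlMr//.
  apply: le_trans; rewrite mulr_ge0 ?(ltW j0)// addr_ge0// ?mulr_ge0 ?divr_ge0//.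
  rewrite -[leLHS](expect_cst (j ^ 40) (j ^ 32) 0 [::])//.
  by apply: ler_expect.
have FC j : (lebesgue_measure (F j) <= (C * (j.+2%:R ^+ 2)^-1)%:E)%E.
  apply: le_trans (cover_measure _ _ _ [::] isT) _.
  by rewrite lee_fin [cyl_len _]/= mul1r HC.
have mF j : measurable (F j) by exact: measurable_cover.
have sumF : (\sum_(n <oo) lebesgue_measure (F n) < +oo)%E.
  apply: (@le_lt_trans _ _ C%:E); last by rewrite ltry.
  apply: lime_le; first by apply: is_cvg_nneseries => *; exact: measure_ge0.
  apply: nearW => n; rewrite big_mkord.
  apply: (@le_trans _ _ (\sum_(j < n) (C * (j.+2%:R ^+ 2)^-1)%:E)%E).
    by apply: lee_sum => j _; exact: FC.
  rewrite sumEFin lee_fin -mulr_sumr -[leRHS]mulr1 ler_wpM2l//.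
  exact: sum_inv_sqr_le1.
have lim0 := lim_sup_set_cvg0 mF sumF.
have aeF : {ae (@lebesgue_measure R), forall w : R, ~ lim_sup_set F w}.
  exists (lim_sup_set F); split => //.
    by apply: bigcap_measurable => // k _; exact: bigcup_measurable.
  by move=> w /= /contrapT.
have fae := ae_filter_ringOfSetsType (@lebesgue_measure R).
apply: (@filterS2 _ _ fae _ _ _ _ aeF ae_nonterminating) => w nF nt w01.
have [k kF] : exists k, forall j, (k <= j)%N -> ~ F j w.
  apply: contrapT => nk; apply: nF => k _; apply: contrapT => nj; apply: nk.
  by exists k => j kj Fj; apply: nj; exists j.
exists k.+2 => // j /= kj; apply/negP => bj.
apply: (kF j.-2); first by rewrite -!subn1 !leq_subRL//; case: j kj {bj} => [|[]].
have -> : F j.-2 = cover (j ^ 40) (j ^ 32) (block_exceptional z j) [::].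
  by rewrite /F; case: j kj {bj} => [|[]].
exact: (mem_cover _ _ _ _ 0 w01 nt).
Qed.
End almost_everywhere.

(** * The limit along powers of j *)

Section gauss_primitive.
Context {R : realType}.
Import gauss_integral_proof.
Implicit Types (s u v x : R).

Local Notation G := (@integral0_gauss R).

Lemma is_derive_integral0_gauss x : 0 < x -> is_derive x 1 G (gauss_fun x).
Proof.
move=> x0.
have [dG <-] : derivable G x 1 /\ derive1 G x = gauss_fun x.
  apply: (@continuous_FTC1 R gauss_fun (BLeft 0) _ (x + 1) _ _ _ _).
  - by rewrite ltrDl.
  - apply: continuous_compact_integrable => //; first exact: segment_compact.
    by apply: continuous_subspaceT; exact: continuous_gauss_fun.
  - by rewrite /=; rewrite lte_fin.
  - by move=> ?; exact: continuous_gauss_fun.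
by rewrite derive1E; apply: DeriveDef.
Qed.

Lemma cvg_integral0_gauss : G x @[x --> +oo] --> Num.sqrt pi / 2.
Proof.
have : Num.sqrt (G x ^+ 2) @[x --> +oo] --> Num.sqrt (pi / 4).
  by apply: continuous_cvg; [exact: sqrt_continuous|exact: cvg_integral0_gauss_sqr].
rewrite sqrtrM ?pi_ge0// sqrtrV// (_ : 4 = 2 ^+ 2); last by rewrite expr2 -natrM.
rewrite sqrtr_sqr ger0_norm//.
by under eq_fun do rewrite sqrtr_sqr ger0_norm ?integral0_gauss_ge0//.
Qed.

Lemma integral0_gauss_le x : 0 <= x -> G x <= x.
Proof.
move=> x0; rewrite /integral0_gauss.
have itg (f : R -> R) : continuous f ->
    (@lebesgue_measure R).-integrable `[0, x]%classic (EFin \o f).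
  move=> cf; apply: continuous_compact_integrable; first exact: segment_compact.
  exact: continuous_subspaceT.
apply: (@le_trans _ _ (\int[@lebesgue_measure R]_(t in `[0, x]) 1)).
  apply: le_Rintegral => //.
  - exact/itg/continuous_gauss_fun.
  - by apply: itg; exact: cst_continuous.
  - by move=> t _; exact: gauss_fun_le1.
rewrite Rintegral_cst//= lebesgue_measure_itv/= lte_fin mul1r.
by case: ifP => _ //=; rewrite subr0.
Qed.

(* Integrating by parts, a primitive of 1 - exp (- (s / u)^2). *)
Definition occ_primitive s u : R := u * (1 - gauss_fun (s / u)) - 2 * s * G (s / u).

Lemma is_derive_occ_primitive s u : 0 < s -> 0 < u ->
  is_derive u 1 (occ_primitive s) (1 - gauss_fun (s / u)).
Proof.
move=> s0 u0; have un0 : u != 0 by rewrite lt0r_neq0.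
have dy : is_derive u 1 (fun u : R => s * u^-1) (- (s / u ^+ 2)).
  have := is_deriveZ s (is_deriveV un0 (is_derive_id u (1 : R))).
  by rewrite /GRing.scale/= mulr1 mulrN.
have y0 : 0 < s * u^-1 by rewrite divr_gt0.
have dG := @is_derive1_comp _ G (fun u => s * u^-1) u _ _
  (is_derive_integral0_gauss _ y0) dy.
have dg0 : is_derive (s * u^-1) 1 (@gauss_fun R)
    (gauss_fun (s * u^-1) * - (2 * (s * u^-1))).
  have H := is_deriveN (is_deriveX 2 (is_derive_id (s * u^-1) (1 : R))).
  have := @is_derive1_comp _ expR (fun t => - t ^+ 2) _ _ _ (is_derive_expR _) H.
  congr is_derive.
  by rewrite /GRing.scale/= !mulr1 expr1 mulr_natl.
have dg := @is_derive1_comp _ gauss_fun (fun u => s * u^-1) u _ _ dg0 dy.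
have := is_deriveB (is_deriveM (is_derive_id u (1 : R))
  (is_deriveB (is_derive_cst (1 : R) u (1 : R)) dg)) (is_deriveZ (2 * s) dG).
congr is_derive.
rewrite /GRing.scale/= [X in _ + X * 1](_ : _ = 1 - gauss_fun (s * u^-1))//.
move: (gauss_fun _) => g; field.
by rewrite un0.
Qed.

Lemma occ_increment s (J : R) (x : nat) : 0 < s -> 0 < J -> (0 < x)%N ->
  1 - gauss_fun (s / (x.+1%:R / J)) <=
    J * (occ_primitive s (x.+1%:R / J) - occ_primitive s (x%:R / J))
  <= 1 - gauss_fun (s / (x%:R / J)).
Proof.
move=> s0 J0 x0; have x1 := @ler1_nat R x x0.
have a0 : 0 < x%:R / J by rewrite divr_gt0//; lra.
have ab : x%:R / J <= x.+1%:R / J by rewrite ler_wpM2r ?ler_nat// invr_ge0 ltW.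
have gmono u v : 0 < u -> u <= v ->
    1 - gauss_fun (s / v) <= 1 - gauss_fun (s / u).
  move=> u0 uv; rewrite lerD2l lerN2 ler_expR lerN2 lerXn2r ?nnegrE ?divr_ge0 ?(ltW s0) ?(ltW u0)//.
    by rewrite (le_trans (ltW u0)).
  by rewrite ler_wpM2l ?(ltW s0)// lef_pV2 ?posrE// (lt_le_trans u0).
have := MVT_bounds (occ_primitive s) (fun u => 1 - gauss_fun (s / u)) _ _
  (1 - gauss_fun (s / (x.+1%:R / J))) (1 - gauss_fun (s / (x%:R / J))) ab.
case/(_ _ _)/andP.
- move=> u /andP[au _]; apply: is_derive_occ_primitive => //.
  exact: lt_le_trans au.
- move=> u /andP[au ub]; rewrite !gmono//.
  exact: lt_le_trans au.
have -> : x.+1%:R / J - x%:R / J = J^-1 by rewrite -natr1; ring.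
rewrite !ler_pdivrMr ?ler_pdivlMr// => lo hi.
by rewrite ![J * _]mulrC hi; apply/andP.
Qed.

(** Riemann sum of a decreasing integrand with values in [0, 1]: the left and right sums enclose the
    integral and differ by f lo - f hi <= 1. *)
Lemma sum_occ s (J : R) (lo hi : nat) : 0 < s -> 0 < J -> (0 < lo <= hi)%N ->
  `|\sum_(lo.+1 <= x < hi.+1) (1 - gauss_fun (s / (x%:R / J)))
    - J * (occ_primitive s (hi%:R / J) - occ_primitive s (lo%:R / J))| <= 1.
Proof.
move=> s0 J0 /andP[lo0 lohi].
pose f (x : nat) : R := 1 - gauss_fun (s / (x%:R / J)).
have f01 (x : nat) : 0 <= f x <= 1.
  by rewrite /f; have := gauss_fun_ge0 (s / (x%:R / J));
    have := gauss_fun_le1 (s / (x%:R / J)); lra.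
have tel : J * (occ_primitive s (hi%:R / J) - occ_primitive s (lo%:R / J)) =
   \sum_(lo <= x < hi) J * (occ_primitive s (x.+1%:R / J) - occ_primitive s (x%:R / J)).
  by rewrite -mulr_sumr telescope_sumr.
have up : \sum_(lo.+1 <= x < hi.+1) f x <=
    J * (occ_primitive s (hi%:R / J) - occ_primitive s (lo%:R / J)).
  rewrite tel big_add1 /= big_nat_cond [leRHS]big_nat_cond; apply: ler_sum => x.
  rewrite andbT => /andP[lx _].
  by have /andP[] := occ_increment s J x s0 J0 (leq_trans lo0 lx).
have low : J * (occ_primitive s (hi%:R / J) - occ_primitive s (lo%:R / J)) <=
    \sum_(lo <= x < hi) f x.
  rewrite tel big_nat_cond [leRHS]big_nat_cond; apply: ler_sum => x.
  rewrite andbT => /andP[lx _].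
  by have /andP[] := occ_increment s J x s0 J0 (leq_trans lo0 lx).
have shift : \sum_(lo <= x < hi) f x + f hi = f lo + \sum_(lo.+1 <= x < hi.+1) f x.
  by rewrite -big_nat_recr// big_ltn ?ltnS.
rewrite -/(\sum_(lo.+1 <= x < hi.+1) f x) in up *.
have := f01 hi; have := f01 lo; rewrite ler_norml.
move: up low shift; move: (J * _) (\sum_(_ <= _ < _) _) (\sum_(_ <= _ < _) _) (f lo) (f hi).
move=> *; lra.
Qed.

(** Both terms of the primitive are nonnegative and are bounded by 1 - exp (- y^2) <= y^2 and G y <=
    y at y = s / u. This makes the upper endpoint of the integral negligible. *)
Lemma occ_primitive_le s u : 0 < s -> 0 < u -> `|occ_primitive s u| <= 2 * s ^+ 2 / u.
Proof.
move=> s0 u0; have y0 : 0 < s / u by rewrite divr_gt0.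
have G0 := integral0_gauss_ge0 (s / u); have G1 := integral0_gauss_le _ (ltW y0).
have g1 := gauss_fun_le1 (s / u).
have g2 : 1 - gauss_fun (s / u) <= (s / u) ^+ 2.
  by rewrite /gauss_fun; have := expR_ge1Dx (- (s / u) ^+ 2 : R); lra.
have a0 : 0 <= u * (1 - gauss_fun (s / u)) by rewrite mulr_ge0 ?(ltW u0)//; lra.
have a1 : u * (1 - gauss_fun (s / u)) <= s ^+ 2 / u.
  apply: (@le_trans _ _ (u * (s / u) ^+ 2)); first by rewrite ler_wpM2l ?(ltW u0).
  by rewrite le_eqVlt; apply/orP; left; apply/eqP; field; rewrite lt0r_neq0.
have b0 : 0 <= 2 * s * G (s / u) by rewrite !mulr_ge0// ltW.
have b1 : 2 * s * G (s / u) <= 2 * (s ^+ 2 / u).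
  apply: (@le_trans _ _ (2 * s * (s / u))).
    by rewrite ler_wpM2l// mulr_ge0// ltW.
  by rewrite le_eqVlt; apply/orP; left; apply/eqP; field; rewrite lt0r_neq0.
have c0 : 0 <= s ^+ 2 / u by rewrite divr_ge0 ?sqr_ge0 ?ltW.
rewrite /occ_primitive -[leRHS]mulrA ler_norml; move: a0 a1 b0 b1 c0.
by move: (s ^+ 2 / u) (2 * s * _) (u * _) => *; lra.
Qed.
End gauss_primitive.

(** * Occupation sums of words *)

Section occupation_sum.
Context {R : realType}.
Implicit Types (z : R) (l : seq nat).

Definition occ_sum z l : R := \sum_(x <- undup l) (1 - z ^+ count_mem x l).

Lemma occ_sum_sub z l (r : seq nat) : uniq r -> {subset l <= r} ->
  occ_sum z l = \sum_(x <- r) (1 - z ^+ count_mem x l).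
Proof.
move=> ur lr; rewrite (bigID (mem l))/= [X in _ = _ + X]big1 ?addr0; last first.
  by move=> x /count_memPn ->; rewrite expr0 subrr.
rewrite -big_filter; apply: perm_big; apply: uniq_perm; rewrite ?undup_uniq ?filter_uniq//.
move=> x; rewrite mem_undup mem_filter; case: (boolP (x \in l)) => //= xl.
by rewrite lr.
Qed.

Lemma occ_term_bounds z l x : 0 <= z <= 1 -> 0 <= 1 - z ^+ count_mem x l <= 1.
Proof. by move=> /andP[z0 z1]; rewrite subr_ge0 exprn_ile1//= gerBl exprn_ge0. Qed.

Lemma occ_sum_cons z a l : 0 <= z <= 1 -> occ_sum z l <= occ_sum z (a :: l).
Proof.
move=> /andP[z0 z1].
rewrite (occ_sum_sub z l (undup (a :: l))) ?undup_uniq//; last first.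
  by move=> x xl; rewrite mem_undup inE xl orbT.
apply: ler_sum => x _; rewrite lerD2l lerN2 /=; case: (a == x) => /=; last by rewrite add0n.
by rewrite add1n exprS ler_piMl// exprn_ge0.
Qed.

(** Each term is at most 1. There are at most lo + 1 values up to [lo], as 0 is allowed in a general
    word, and at most [tail_count] distinct values above [hi]. *)
Lemma occ_sum_approx z l lo hi : 0 <= z <= 1 ->
  Wmid z lo hi l <= occ_sum z l <= Wmid z lo hi l + lo.+1%:R + tail_count hi l.
Proof.
move=> z01; pose mid x := (lo < x <= hi)%N.
have midE : Wmid z lo hi l = \sum_(x <- undup l | mid x) (1 - z ^+ count_mem x l).
  rewrite /Wmid (bigID (mem l))/= [X in _ + X]big1 ?addr0; last first.
    by move=> x /count_memPn ->; rewrite expr0 subrr.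
  rewrite -big_filter -[RHS]big_filter; apply: perm_big.
  apply: uniq_perm; rewrite ?filter_uniq ?undup_uniq ?iota_uniq//.
  by move=> x; rewrite !mem_filter mem_index_iota mem_undup ltnS andbC.
rewrite /occ_sum (bigID mid)/= -midE lerDl sumr_ge0/=; last first.
  by move=> x _; have /andP[] := occ_term_bounds z l x z01.
rewrite -addrA lerD2l (bigID (fun x => x <= lo)%N)/= lerD//.
- apply: (@le_trans _ _ (\sum_(x <- undup l | (x <= lo)%N) 1)).
    rewrite [leRHS](bigID (fun x => ~~ mid x))/=.
    rewrite [X in _ <= X + _](eq_bigl (fun x => ~~ mid x && (x <= lo)%N)); last first.
      by move=> x; rewrite andbC.
    rewrite ler_wpDr ?sumr_ge0//; apply: ler_sum => x _.
    by have /andP[] := occ_term_bounds z l x z01.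
  rewrite -big_filter big_const_seq count_predT iter_addr_0 ler_nat.
  rewrite -(size_iota 0 lo.+1); apply: uniq_leq_size; first by rewrite filter_uniq ?undup_uniq.
  by move=> x; rewrite mem_filter mem_iota => /andP[].
- apply: (@le_trans _ _ (\sum_(x <- undup l | (hi < x)%N) 1)).
    rewrite [leLHS](eq_bigl (fun x => (hi < x)%N && (lo < x)%N)); last first.
      by move=> x; rewrite /mid -!ltnNge; case: (leqP x lo); case: (leqP x hi).
    rewrite [leRHS](bigID (fun x => lo < x)%N)/= ler_wpDr ?sumr_ge0//; apply: ler_sum => x _.
    by have /andP[] := occ_term_bounds z l x z01.
  rewrite -big_filter big_const_seq count_predT iter_addr_0 ler_nat size_filter.
  exact: leq_count_subseq (undup_subseq _).
Qed.

End occupation_sum.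

(** * From the subsequence of powers to all n *)

Section interpolation.
Context {R : realType}.

Lemma cvg_harmonic_approx (a b : nat -> R) (K L : R) :
  (\forall j \near \oo, `|a j - b j| <= K / j%:R) ->
  b @ \oo --> L -> a @ \oo --> L.
Proof.
move=> ab bL; have K0 : (fun j : nat => K / j%:R) @ \oo --> (0 : R).
  rewrite -[X in _ --> X](mulr0 K); apply: cvgMr.
  apply/gtr0_cvgV0; last exact: cvgr_idn.
  by exists 1%N => // j /=; rewrite ltr0n.
have d0 : (fun j => a j - b j) @ \oo --> (0 : R).
  apply: (@squeeze_cvgr _ _ _ _ (fun j : nat => - (K / j%:R)) (fun j : nat => K / j%:R)).
  - by near=> j; rewrite -ler_norml; near: j.
  - by rewrite -[X in _ --> X]oppr0; exact: cvgN.
  - exact: K0.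
rewrite [a](_ : _ = fun j => (a j - b j) + b j); last first.
  by apply/funext => j; rewrite subrK.
by rewrite -[L]add0r; exact: cvgD.
Unshelve. all: by end_near. Qed.

Lemma floor_root_ex p n : (0 < p)%N -> exists j, (j ^ p <= n < j.+1 ^ p)%N.
Proof.
move=> p0; elim: n => [|n [j /andP[jn nj]]]; first by exists 0%N; rewrite exp0n// exp1n.
have [nj'|nj'] := ltnP n.+1 (j.+1 ^ p); first by exists j; rewrite nj' leqW.
by exists j.+1; rewrite nj' (leq_ltn_trans nj)// ltn_exp2r.
Qed.

Lemma cvg_shift_ratio p : (fun j : nat => ((j.+1%:R / j%:R) ^+ p : R)) @ \oo --> (1 : R).
Proof.
have ratio1 : (fun j : nat => (j.+1%:R / j%:R : R)) @ \oo --> (1 : R).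
  apply: (@cvg_harmonic_approx _ (fun=> 1) 1); last exact: cvg_cst.
  near=> j; have j0 : 0 < j%:R :> R by rewrite ltr0n; near: j; exists 1%N.
  rewrite -natr1 mulrDl divff ?lt0r_neq0// addrC addKr.
  by rewrite ger0_norm// divr_ge0// ltW.
rewrite -[X in _ --> X](expr1n R p).
exact: (continuous_cvg _ (@exprn_continuous R p 1) ratio1).
Unshelve. all: by end_near. Qed.

(** If r is the integer part of the 2p-th root of n, monotonicity puts f n between its values at
    r^(2p) and (r + 1)^(2p), while sqrt n lies between r^p and (r + 1)^p, whose ratio tends to 1. *)
Lemma cvg_interpolation (f : nat -> R) p (L : R) : (0 < p)%N ->
  (forall n, 0 <= f n) -> {homo f : m n / (m <= n)%N >-> m <= n} ->
  (fun j => f (j ^ p.*2)%N / j%:R ^+ p) @ \oo --> L ->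
  (fun n => f n / Num.sqrt n%:R) @ \oo --> L.
Proof.
move=> p0 f0 fmono fL; have p20 : (0 < p.*2)%N by rewrite double_gt0.
have /choice[r rE] := fun n => floor_root_ex p.*2 n p20.
have roo : r @ \oo --> \oo.
  move=> A [N _ NA]; exists (N ^ p.*2)%N => // n /= Nn; apply: NA => /=.
  rewrite -ltnS -(ltn_exp2r _ _ p20).
  by have /andP[_] := rE n; exact: leq_ltn_trans.
have r_gt0 : \forall n \near \oo, (0 < r n)%N.
  by apply: (roo [set k | (0 < k)%N]); exists 1%N.
pose g j := f (j ^ p.*2)%N / j%:R ^+ p.
have lowL : (fun j => g j * ((j.+1%:R / j%:R) ^+ p)^-1) @ \oo --> L.
  rewrite -[X in _ --> X]mulr1; apply: cvgM; first exact: fL.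
  by rewrite -[X in _ --> X]invr1; apply: cvgV; [exact: oner_neq0|exact: cvg_shift_ratio].
have upL : (fun j => g j.+1 * (j.+1%:R / j%:R) ^+ p) @ \oo --> L.
  rewrite -[X in _ --> X]mulr1; apply: cvgM; last exact: cvg_shift_ratio.
  by rewrite (cvg_shiftS g).
apply: (@squeeze_cvgr _ _ _ _ (fun n => g (r n) * (((r n).+1%:R / (r n)%:R) ^+ p)^-1)
  (fun n => g (r n).+1 * ((r n).+1%:R / (r n)%:R) ^+ p)); last 2 first.
- exact: cvg_comp roo lowL.
- exact: cvg_comp roo upL.
near=> n.
have r0 : (0 < r n)%N by near: n.
have /andP[rn nr] := rE n.
have rR : 0 < (r n)%:R :> R by rewrite ltr0n.
have rS : 0 < (r n).+1%:R :> R by rewrite ltr0n.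
have sqrtX (j : nat) : Num.sqrt ((j ^ p.*2)%N%:R : R) = j%:R ^+ p.
  by rewrite natrX -mul2n mulnC exprM sqrtr_sqr ger0_norm ?exprn_ge0.
have s1 : (r n)%:R ^+ p <= Num.sqrt n%:R :> R.
  by rewrite -sqrtX ler_sqrt ?ler_nat.
have s2 : Num.sqrt n%:R <= (r n).+1%:R ^+ p :> R.
  by rewrite -sqrtX ler_sqrt ?ler_nat// ltnW.
have sn0 : 0 < Num.sqrt n%:R :> R by apply: lt_le_trans s1; rewrite exprn_gt0.
rewrite /g !expr_div_n invf_div mulrA divfK ?expf_neq0 ?lt0r_neq0//.
rewrite [X in _ <= _ <= X]mulrA divfK ?expf_neq0 ?lt0r_neq0//.
apply/andP; split.
  rewrite ler_pM ?invr_ge0 ?exprn_ge0//; first exact: fmono.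
  by rewrite lef_pV2 ?posrE ?exprn_gt0.
rewrite ler_pM ?invr_ge0 ?sqrtr_ge0//; first exact/fmono/ltnW.
by rewrite lef_pV2 ?posrE ?exprn_gt0.
Unshelve. all: by end_near. Qed.
End interpolation.

(** * Almost sure limit of the occupation sums *)

Section occ_limit.
Context {R : realType}.
Import gauss_integral_proof.
Implicit Types (z w : R).

(** The s for which [expect_occ] is exp (- (s / u)^2) in the variable u = x / sqrt n. *)
Definition occ_scale z : R := Num.sqrt ((1 - z) / ln 2).

Lemma occ_scale_gt0 z : z < 1 -> 0 < occ_scale z.
Proof.
move=> z1; rewrite sqrtr_gt0 divr_gt0 ?subr_gt0//.
by have := @ln2_ge R; lra.
Qed.

Lemma occ_scale_sqr z : z <= 1 -> occ_scale z ^+ 2 = (1 - z) / ln 2.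
Proof.
move=> z1; rewrite sqr_sqrtr// divr_ge0 ?subr_ge0//.
by have := @ln2_ge R; lra.
Qed.

Lemma expect_occ_gauss z (m x : nat) : z <= 1 -> (0 < x)%N -> (0 < m)%N ->
  expect_occ z (m ^ 2) x = gauss_fun (occ_scale z / (x%:R / m%:R)).
Proof.
move=> z1 x0 m0; rewrite /expect_occ /delta1 /gauss_fun; congr (expR (- _)).
rewrite [RHS]exprMn occ_scale_sqr// natrX; field.
have := @ln2_ge R => l2; rewrite !lt0r_neq0 ?ltr0n//; lra.
Qed.

(** In units of sqrt n = j^16 the sum runs from 1 / j to j^3. The upper endpoint contributes
    O(j^13); the lower one gives the main term and a remainder of at most j^15. *)
Lemma Wmean_approx z (j : nat) : 0 <= z < 1 -> (0 < j)%N ->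
  `|Wmean z (j ^ 15) (j ^ 19) (j ^ 32)
    - j%:R ^+ 16 * (2 * occ_scale z * integral0_gauss (occ_scale z * j%:R))|
  <= (2 + 2 * occ_scale z ^+ 2) * j%:R ^+ 15.
Proof.
move=> /andP[z0 z1] j0; set s := occ_scale z; have s0 : 0 < s by exact: occ_scale_gt0.
set x : R := j%:R; have x1 : 1 <= x by rewrite (ler_nat _ 1).
have x0 : 0 < x by lra.
have xn0 : x != 0 by rewrite lt0r_neq0.
have J0 : 0 < x ^+ 16 by rewrite exprn_gt0.
have lohi : (0 < j ^ 15 <= j ^ 19)%N by rewrite expn_gt0 j0 leq_pexp2l.
have -> : Wmean z (j ^ 15) (j ^ 19) (j ^ 32) =
    \sum_((j ^ 15).+1 <= y < (j ^ 19).+1) (1 - gauss_fun (s / (y%:R / x ^+ 16))).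
  rewrite /Wmean big_nat_cond [RHS]big_nat_cond; apply: eq_bigr => y.
  rewrite andbT => /andP[ly _].
  rewrite (_ : j ^ 32 = (j ^ 16) ^ 2)%N; last by rewrite -expnM.
  rewrite expect_occ_gauss ?(ltW z1) ?expn_gt0 ?j0 ?natrX//.
  by apply: leq_trans ly; rewrite ltnS.
have main := sum_occ s (x ^+ 16) _ _ s0 J0 lohi.
have hi0 : 0 < (j ^ 19)%:R / x ^+ 16 :> R by rewrite natrX divr_gt0// exprn_gt0.
have hiE : (j ^ 19)%:R / x ^+ 16 = x ^+ 3 :> R.
  by rewrite natrX -/x (exprD x 3 16) mulfK// expf_neq0.
have loE : (j ^ 15)%:R / x ^+ 16 = x^-1 :> R.
  by rewrite natrX -/x (exprD x 1 15) invfM expr1 mulrCA divff ?expf_neq0// mulr1.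
have hi_le := occ_primitive_le s _ s0 hi0.
rewrite hiE loE in main hi_le.
have loP : occ_primitive s x^-1 = x^-1 * (1 - gauss_fun (s * x)) - 2 * s * integral0_gauss (s * x).
  by rewrite /occ_primitive invrK.
rewrite loP in main.
have g0 := gauss_fun_ge0 (s * x); have g1 := gauss_fun_le1 (s * x).
have T1 : `|x ^+ 16 * occ_primitive s (x ^+ 3)| <= 2 * s ^+ 2 * x ^+ 15.
  rewrite normrM ger0_norm ?(ltW J0)//.
  apply: le_trans (ler_wpM2l (ltW J0) hi_le) _.
  rewrite (_ : x ^+ 16 * (2 * s ^+ 2 / x ^+ 3) = 2 * s ^+ 2 * x ^+ 13).
    by apply: ler_wpM2l; [rewrite mulr_ge0 ?sqr_ge0|exact: ler_weXn2l].
  by rewrite (exprD x 13 3) mulrCA mulfK// expf_neq0.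
have T2 : 0 <= x ^+ 16 * (x^-1 * (1 - gauss_fun (s * x))) <= x ^+ 15.
  rewrite (exprS x 15) mulrA [x * _ / x]mulrAC divff// mul1r.
  have p0 : 0 <= x ^+ 15 by rewrite exprn_ge0 ?ltW.
  rewrite mulr_ge0 ?subr_ge0//= ler_piMr//; lra.
have T3 : 1 <= x ^+ 15 by rewrite exprn_ege1.
move: main T1; rewrite !ler_norml.
rewrite (_ : _ - x ^+ 16 * (_ - (_ - _)) =
   \sum_((j ^ 15).+1 <= y < (j ^ 19).+1) (1 - gauss_fun (s / (y%:R / x ^+ 16)))
   - x ^+ 16 * occ_primitive s (x ^+ 3) + x ^+ 16 * (x^-1 * (1 - gauss_fun (s * x)))
   - x ^+ 16 * (2 * s * integral0_gauss (s * x))); last by ring.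
rewrite (mulrDl 2); move: T2 T3.
move: (\sum_(_ <= _ < _) _) (x ^+ 15) (2 * s ^+ 2 * _) (x ^+ 16 * _) (x ^+ 16 * _) (x ^+ 16 * _).
by move=> *; lra.
Qed.

(** In units of j^15 the errors are 2 for the values up to [lo], 1 for the large digits, 1 for the
    deviation from the mean and 2 + 2 s^2 for [Wmean]. *)
Lemma occ_sum_not_exceptional z (j : nat) l : 0 <= z < 1 -> (0 < j)%N ->
  ~~ block_exceptional z j l ->
  `|occ_sum z l / j%:R ^+ 16 - 2 * occ_scale z * integral0_gauss (occ_scale z * j%:R)|
  <= (6 + 2 * occ_scale z ^+ 2) / j%:R.
Proof.
move=> z01 j0; have /andP[z0 z1] := z01.
rewrite /block_exceptional /exceptional negb_or -!ltNge => /andP[W T].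
have x1 : 1 <= j%:R :> R by rewrite (ler_nat _ 1).
have := Wmean_approx z j z01 j0.
have := occ_sum_approx z l (j ^ 15) (j ^ 19) ltac:(by rewrite z0 ltW).
rewrite -natr1 natrX; move: W T x1.
move: (occ_sum z l) (Wmid _ _ _ _) (tail_count _ _) (Wmean _ _ _ _) => o a t m.
move: (occ_scale z) => s; move: (2 * s * _) => g.
move: (j%:R : R) => x /ltW W /ltW T x1 /andP[lb1 ub1] M.
have x0 : 0 < x by lra.
have xn0 : x != 0 by rewrite lt0r_neq0.
have p0 : 0 < x ^+ 16 by rewrite exprn_gt0.
have -> : o / x ^+ 16 - g = (o - x ^+ 16 * g) / x ^+ 16.
  by rewrite mulrBl mulrAC divff ?mul1r// expf_neq0.
rewrite normrM [`|_^-1|]ger0_norm ?invr_ge0 ?(ltW p0)// ler_pdivrMr//.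
rewrite [leRHS](_ : _ = (6 + 2 * s ^+ 2) * x ^+ 15); last first.
  by rewrite (exprS x 15) [LHS]mulrA divfK.
have T3 : 1 <= x ^+ 15 by rewrite exprn_ege1.
rewrite (mulrDl 6) ; rewrite (mulrDl 2) in M.
move: W M; rewrite !ler_norml; move: T T3 lb1 ub1.
move: (x ^+ 15) (2 * s ^+ 2 * _) (x ^+ 16 * g) => *; lra.
Qed.

Lemma ae_occ_sum_limit z : 0 <= z < 1 ->
  {ae (@lebesgue_measure R), forall w : R, 0 < w < 1 ->
    (fun n : nat => occ_sum z (rev_prefix w n) / Num.sqrt n%:R) @ \oo
      --> Num.sqrt (pi / ln 2) * Num.sqrt (1 - z)}.
Proof.
move=> z01; have /andP[z0 z1] := z01; have z01' : 0 <= z <= 1 by rewrite z0 ltW.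
have fae := ae_filter_ringOfSetsType (@lebesgue_measure R).
move: (ae_not_exceptional z z01'); apply: (@filterS _ _ fae) => w nex w01.
have s0 := occ_scale_gt0 z z1.
apply: (cvg_interpolation _ 16) => //.
- by move=> n; rewrite sumr_ge0// => x _; have /andP[] := occ_term_bounds z (rev_prefix w n) x z01'.
- apply: homo_leq => // [n|n]; first exact: le_trans.
  by rewrite rev_prefixS occ_sum_cons.
apply: (cvg_harmonic_approx _ (fun j => 2 * occ_scale z * integral0_gauss (occ_scale z * j%:R))
  (6 + 2 * occ_scale z ^+ 2)).
  near=> j; apply: occ_sum_not_exceptional => //; last by near: j; exact: nex.
  by near: j; exists 1%N.
have -> : Num.sqrt (pi / ln 2) * Num.sqrt (1 - z) = 2 * occ_scale z * (Num.sqrt pi / 2) :> R.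
  have l2 := @ln2_ge R.
  rewrite /occ_scale -[LHS]sqrtrM ?divr_ge0 ?pi_ge0//; last lra.
  by rewrite mulrAC -mulrA sqrtrM ?pi_ge0//; field.
have sj : (fun j : nat => occ_scale z * j%:R) @ \oo --> +oo.
  exact: cvg_comp (@cvgr_idn R) (gt0_cvgMry s0 (@cvg_id _ _)).
have Gj : (fun j : nat => integral0_gauss (occ_scale z * j%:R)) @ \oo --> Num.sqrt pi / 2.
  exact: cvg_comp sj cvg_integral0_gauss.
by apply: cvgM; [exact: cvg_cst|exact: Gj].
Unshelve. all: by end_near. Qed.
End occ_limit.

(** * From generating functions to coefficients *)

Section generating_function.
Context {R : realType}.

(** The coefficients of (1 - t)^(-1/2). *)
Definition central (k : nat) : R := 'C(k.*2, k)%:R / 4 ^+ k.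

Lemma central0 : central 0 = 1.
Proof. by rewrite /central bin0 expr0 divr1. Qed.

Lemma centralS k : central k.+1 * (2 * k.+1%:R) = central k * (2 * k%:R + 1).
Proof.
have binS : ('C(k.+1.*2, k.+1) * k.+1 = 2 * (k.*2.+1 * 'C(k.*2, k)))%N.
  rewrite doubleS binS -[X in (_ + X)%N]bin_sub; last by rewrite -addnn; lia.
  rewrite (_ : k.*2.+1 - k = k.+1)%N; last by lia.
  by rewrite addnn -mul2n -mulnA [(_ * k.+1)%N]mulnC -mul_bin_diag.
have e : 'C(k.+1.*2, k.+1)%:R * k.+1%:R =
    2 * ((2 * k%:R + 1) * 'C(k.*2, k)%:R) :> R.
  by rewrite -natrM binS 2!natrM -(natr1 k.*2) -[in (k.*2)%:R]mul2n natrM.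
rewrite /central exprS invfM.
have -> : 'C(k.+1.*2, k.+1)%:R * (4^-1 / 4 ^+ k) * (2 * k.+1%:R) =
  'C(k.+1.*2, k.+1)%:R * k.+1%:R * (2^-1 / 4 ^+ k) :> R.
  by field; rewrite expf_neq0.
by rewrite e; field; rewrite expf_neq0.
Qed.

Lemma central_ge0 k : 0 <= central k.
Proof. by rewrite divr_ge0 ?exprn_ge0. Qed.

Lemma rkE k : (0 < k)%N -> rk k = central k / (2 * k%:R - 1).
Proof.
move=> k0; rewrite /rk /central; have k1 := @ler1_nat R k k0.
rewrite natrB ?double_gt0// -muln2 natrM mulrC; field.
by rewrite expf_neq0//= lt0r_neq0//; lra.
Qed.

Lemma rkS_central k : rk k.+1 * (2 * k.+1%:R) = central k.
Proof.
rewrite rkE//; have := centralS k; rewrite -!(natr1 k).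
have k0 : 0 <= k%:R :> R by [].
move: (central _) (central _) (k%:R : R) k0 => c' c x x0 e.
have -> : 2 * (x + 1) - 1 = 2 * x + 1 by ring.
have x1 : 2 * x + 1 != 0 by rewrite lt0r_neq0//; lra.
by rewrite mulrAC e mulfK.
Qed.

(** Coefficientwise form of sqrt (1 - t) = (1 - t) (1 - t)^(-1/2); it makes the sum of the r_k
    telescope. *)
Lemma rkS_diff k : rk k.+1 = central k - central k.+1.
Proof.
have := rkS_central k; have := centralS k; rewrite -!(natr1 k).
have k0 : 0 <= k%:R :> R by [].
move: (rk _) (central _) (central _) (k%:R : R) k0 => r c' c x x0 e1 e2.
have x1 : 2 * (x + 1) != 0 by rewrite lt0r_neq0//; lra.
by apply: (mulIf x1); rewrite e2 mulrBl e1; ring.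
Qed.

Lemma sum_rk n : \sum_(1 <= k < n.+1) rk k = 1 - central n.
Proof.
rewrite big_add1 /= (telescope_sumr_eq (fun k => - central k))//.
  by rewrite central0 opprK addrC.
by move=> k _; rewrite rkS_diff; ring.
Qed.

(** The quotient of consecutive left-hand sides is (2n + 1)(2n + 3) / (2n + 2)^2 < 1. *)
Lemma central_sqr_le n : central n ^+ 2 * (2 * n%:R + 1) <= 1.
Proof.
elim: n => [|n IH]; first by rewrite central0 expr1n mulr0 add0r mulr1.
have := centralS n; rewrite -!(natr1 n).
have n0 : 0 <= n%:R :> R by [].
move: (central n.+1) (central n) (n%:R : R) n0 IH => c' c x x0 IH e.
have d0 : 0 < 2 * (x + 1) by lra.
rewrite -(ler_pM2r (exprn_gt0 2 d0)) mul1r mulrAC -exprMn e exprMn.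
rewrite (_ : c ^+ 2 * (2 * x + 1) ^+ 2 * (2 * (x + 1) + 1) =
  (c ^+ 2 * (2 * x + 1)) * ((2 * x + 1) * (2 * x + 3))); last by ring.
have B : 0 <= (2 * x + 1) * (2 * x + 3) by rewrite mulr_ge0//; lra.
by apply: (le_trans (ler_piMl B IH)); rewrite expr2; lra.
Qed.

Lemma central_cvg0 : central @ \oo --> (0 : R).
Proof.
have c2 : (fun n => central n ^+ 2) @ \oo --> (0 : R).
  apply: (cvg_harmonic_approx _ (fun=> 0) 1); last exact: cvg_cst.
  near=> n; have n0 : 0 < n%:R :> R by rewrite ltr0n; near: n; exists 1%N.
  rewrite subr0 ger0_norm ?sqr_ge0// ler_pdivlMr//.
  apply: le_trans (central_sqr_le n); rewrite ler_wpM2l ?sqr_ge0//; lra.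
have -> : central = (fun n => Num.sqrt (central n ^+ 2)).
  by apply/funext => n; rewrite sqrtr_sqr ger0_norm ?central_ge0.
rewrite -[X in _ --> X]sqrtr0.
exact: (continuous_cvg _ (@sqrt_continuous R 0) c2).
Unshelve. all: by end_near. Qed.

Lemma rk_ge0 k : 0 <= rk k :> R.
Proof. by rewrite divr_ge0 ?mulr_ge0 ?exprn_ge0. Qed.

Lemma central_le1 n : central n <= 1.
Proof.
rewrite -subr_ge0 -sum_rk; apply: sumr_ge0 => k _; exact: rk_ge0.
Qed.

Definition rk_poly K (t : R) : R := \sum_(1 <= k < K.+1) rk k * t ^+ k.
Definition rk_poly' K (t : R) : R := \sum_(1 <= k < K.+1) rk k * (k%:R * t ^+ k.-1).

Lemma is_derive_rk_poly K (t : R) : is_derive t 1 (rk_poly K) (rk_poly' K t).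
Proof.
apply: (is_derive_sum_nat (fun k t => rk k * t ^+ k)
  (fun k t => rk k * (k%:R * t ^+ k.-1))) => k _.
have := is_deriveZ (rk k) (is_deriveX k (is_derive_id t (1 : R))).
congr is_derive; last by rewrite /GRing.scale/= mulr1.
by apply/funext => x; rewrite /= exprfctE.
Qed.

(* The truncation of the differential equation [2 (1 - t) f' = 1 - f]
   satisfied by f = 1 - sqrt (1 - t). *)
Lemma rk_poly_ode K (t : R) :
  1 - rk_poly K t - 2 * (1 - t) * rk_poly' K t = central K * t ^+ K.
Proof.
elim: K => [|K IH].
  by rewrite /rk_poly /rk_poly' !big_geq// central0 expr0; ring.
have := rkS_central K; have := rkS_diff K; move: IH.
rewrite /rk_poly /rk_poly' ![\sum_(1 <= k < K.+2) _]big_nat_recr//= exprS.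
move: (\sum_(_ <= _ < _) _) (\sum_(_ <= _ < _) _) (rk K.+1) (central K.+1) (central K).
move: (t ^+ K) (K.+1%:R : R) => u x P' P r c' c e1 e2 e3.
have -> : c' = c - r by rewrite e2; ring.
rewrite (_ : 1 - _ - _ = (1 - P - 2 * (1 - t) * P') - r * (t * u)
  - 2 * (1 - t) * (r * (x * u))); last by ring.
by rewrite e1 -e3; ring.
Qed.
Lemma rk_poly_bounds K (t : R) : 0 <= t <= 1 -> 0 <= rk_poly K t <= 1.
Proof.
move=> /andP[t0 t1]; rewrite /rk_poly sumr_ge0/=; last first.
  by move=> k _; rewrite mulr_ge0 ?rk_ge0 ?exprn_ge0.
apply: (@le_trans _ _ (\sum_(1 <= k < K.+1) rk k)).
  by apply: ler_sum => k _; rewrite ler_piMr ?rk_ge0 ?exprn_ile1.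
by rewrite sum_rk gerBl central_ge0.
Qed.

(** For 1 - sqrt (1 - t) in place of the polynomial, [H] would be constantly 1. By [rk_poly_ode] its
    derivative lies between 0 and 4 z^K on [0, z], so H z - 1 is at most 4 z^(K+1). *)
Lemma rk_poly_approx K (z : R) : 0 <= z <= 1 / 2 ->
  0 <= 1 - Num.sqrt (1 - z) - rk_poly K z <= 4 * z ^+ K.+1.
Proof.
move=> /andP[z0 z2].
pose H (t : R) := (1 - rk_poly K t) ^+ 2 * (1 - t)^-1.
pose H' (t : R) := (1 - rk_poly K t) * (central K * t ^+ K) * (1 - t) ^- 2.
have dH t : 0 <= t <= z -> is_derive t 1 H (H' t).
  move=> /andP[t0 tz]; have t1 : 1 - t != 0 by rewrite lt0r_neq0//; lra.
  have d1 := is_deriveB (is_derive_cst (1 : R) t (1 : R)) (is_derive_rk_poly K t).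
  have d2 := is_deriveB (is_derive_cst (1 : R) t (1 : R)) (is_derive_id t (1 : R)).
  have := is_deriveM (is_deriveX 2 d1) (@is_deriveV _ (fun t => 1 - t) _ _ _ t1 d2).
  congr is_derive.
  rewrite /GRing.scale/= /H' -rk_poly_ode [LHS](_ : _ =
    (1 - rk_poly K t) ^+ 2 * (- (1 - t) ^- 2 * (0 - 1)) +
    (1 - t)^-1 * (2 * (1 - rk_poly K t) * (0 - rk_poly' K t)))//.
  by field.
have H'b t : 0 <= t <= z -> 0 <= H' t <= 4 * z ^+ K.
  move=> /andP[t0 tz]; have t01 : 0 <= t <= 1 by rewrite t0; lra.
  have /andP[p0 p1] := rk_poly_bounds K t t01.
  have c0 := central_ge0 K; have c1 := central_le1 K.
  have tK0 : 0 <= t ^+ K by rewrite exprn_ge0.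
  have tK : t ^+ K <= z ^+ K by rewrite lerXn2r ?nnegrE.
  have v0 : 0 <= (1 - t) ^- 2 by rewrite invr_ge0 sqr_ge0.
  have v4 : (1 - t) ^- 2 <= 4.
    have d0 : 0 < (1 - t) ^+ 2 by rewrite exprn_gt0//; lra.
    by rewrite -[leLHS]mul1r ler_pdivrMr//; nra.
  have a0 : 0 <= (1 - rk_poly K t) * (central K * t ^+ K).
    by rewrite !mulr_ge0// subr_ge0.
  have a1 : (1 - rk_poly K t) * (central K * t ^+ K) <= z ^+ K.
    apply: le_trans tK; rewrite -[leRHS]mul1r ler_pM ?mulr_ge0 ?subr_ge0//; first lra.
    by rewrite ler_piMl.
  by rewrite /H' mulr_ge0//= mulrC ler_pM.
have := MVT_bounds H H' 0 z 0 (4 * z ^+ K) z0 dH H'b.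
have H0 : H 0 = 1.
  rewrite /H /rk_poly big_nat_cond big1 ?subr0 ?expr1n ?invr1 ?mulr1// => k.
  by rewrite andbT => /andP[k0 _]; rewrite expr0n gtn_eqF// mulr0.
rewrite H0 mul0r !subr0 -mulrA -exprSr => /andP[h0 h4].
have z01 : 0 <= z <= 1 by rewrite z0; lra.
have /andP[p0 p1] := rk_poly_bounds K z z01.
have HE : H z * (1 - z) = (1 - rk_poly K z) ^+ 2.
  by rewrite /H divfK// lt0r_neq0//; lra.
set q := Num.sqrt (1 - z); have q0 : 0 <= q by exact: sqrtr_ge0.
have q2 : q ^+ 2 = 1 - z by rewrite sqr_sqrtr//; lra.
have q1 : 1 / 2 <= q.
  have q4 : (1 / 2) ^+ 2 <= q ^+ 2 by rewrite q2; lra.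
  by move: q4; rewrite ler_pXn2r ?nnegrE// divr_ge0.
have zK0 : 0 <= z ^+ K.+1 by rewrite exprn_ge0.
rewrite [_ - q - _](_ : _ = (1 - rk_poly K z) - q); last by ring.
move: p0 p1 HE h0 h4 zK0; move: (rk_poly K z) (H z) (z ^+ K.+1) => P h zK.
move=> P0 P1 hE h0 h4 zK0.
have D0 : 0 <= (1 - P) ^+ 2 - q ^+ 2 by rewrite -hE q2; nra.
have D4 : (1 - P) ^+ 2 - q ^+ 2 <= 4 * zK by rewrite -hE q2; nra.
have qP : q <= 1 - P.
  have PP : 0 <= 1 - P by lra.
  by rewrite -(ler_pXn2r (_ : 0 < 2)%N) ?nnegrE// -subr_ge0.
apply/andP; split; first lra.
(* The difference of squares dominates the difference, since 1 - P >= q >= 1/2 makes the sum at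
   least 1. *)
apply: le_trans D4; rewrite subr_sqr ler_peMr//; lra.
Qed.
End generating_function.

Section coefficient_extraction.
Context {R : realType}.

Lemma cvg_sum_nat (u : nat -> nat -> R) (l : nat -> R) m n :
  (forall k, (m <= k < n)%N -> u k @ \oo --> l k) ->
  (fun i => \sum_(m <= k < n) u k i) @ \oo --> \sum_(m <= k < n) l k.
Proof.
elim: n => [|n IH] ul.
  by under eq_fun do rewrite big_geq//; rewrite big_geq//; exact: cvg_cst.
have [mn|nm] := leqP m n; last first.
  by under eq_fun do rewrite big_geq//; rewrite big_geq//; exact: cvg_cst.
under eq_fun do rewrite big_nat_recr//=; rewrite big_nat_recr//=.
apply: cvgD; first by apply: IH => k /andP[mk kn]; apply: ul; rewrite mk leqW.
by apply: ul; rewrite mn leqnn.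
Qed.

(* Extracting coefficients from generating functions at points z tending to 0:
   once the coefficients below K are known to converge, the K-th one is
   determined up to O(z). *)
Lemma coef_limit (V : R -> nat -> R) (rho : nat -> nat -> R) :
  (forall i : nat, V i.+2%:R^-1 @ \oo --> Num.sqrt (1 - i.+2%:R^-1)) ->
  (forall i K : nat, \forall n \near \oo,
    0 <= 1 - V i.+2%:R^-1 n - \sum_(1 <= k < K.+1) i.+2%:R^-1 ^+ k * rho k n
      <= i.+2%:R^-1 ^+ K.+1) ->
  forall k, (0 < k)%N -> rho k @ \oo --> (rk k : R).
Proof.
move=> VL Vrho; elim/ltn_ind => -[//|K] IH _.
apply/cvgrPdist_le => eps eps0.
(* After division by z^(K+1) the tail of the limit series costs 4 z and that of the counts costs z;
   the other half of [eps] is for the convergence of [U]. *)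
have [i zi] : exists i : nat, 5 * i.+2%:R^-1 <= eps / 2 :> R.
  exists (Num.truncn (10 / eps)).
  have e0 : 0 <= 10 / eps by rewrite divr_ge0// ltW.
  have /andP[_ lt] := truncn_itv e0.
  have lt2 : 10 / eps <= (Num.truncn (10 / eps)).+2%:R.
    by rewrite (le_trans (ltW lt))// ler_nat.
  move: lt2; rewrite ler_pdivrMr// => lt2.
  by rewrite ler_pdivrMr ?ltr0n//; lra.
set z : R := i.+2%:R^-1 in zi.
have z0 : 0 < z by rewrite invr_gt0.
have z2 : z <= 1 / 2 by rewrite /z div1r lef_pV2 ?posrE// ler_nat.
pose U n := 1 - V z n - \sum_(1 <= k < K.+1) z ^+ k * rho k n.
have UL : U @ \oo --> 1 - Num.sqrt (1 - z) - \sum_(1 <= k < K.+1) z ^+ k * rk k.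
  apply: cvgB; first by apply: cvgB; [exact: cvg_cst|exact: VL].
  apply: cvg_sum_nat => k /andP[k0 kK].
  by apply: cvgM; [exact: cvg_cst|exact: IH].
have zK : 0 < z ^+ K.+1 by rewrite exprn_gt0.
have ez : 0 < z ^+ K.+1 * (eps / 2) by rewrite mulr_gt0// divr_gt0.
near=> n.
have Un : `|1 - Num.sqrt (1 - z) - \sum_(1 <= k < K.+1) z ^+ k * rk k - U n|
    <= z ^+ K.+1 * (eps / 2).
  by near: n; move/cvgrPdist_le : UL; exact.
have : 0 <= 1 - V z n - \sum_(1 <= k < K.+2) z ^+ k * rho k n <= z ^+ K.+2.
  by near: n; exact: Vrho.
have := rk_poly_approx K.+1 z ltac:(by rewrite (ltW z0)).
rewrite /rk_poly big_nat_recr//= [X in _ -> 0 <= _ - X <= _ -> _]big_nat_recr//=.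
have -> : \sum_(1 <= k < K.+1) rk k * z ^+ k = \sum_(1 <= k < K.+1) z ^+ k * rk k.
  by apply: eq_bigr => k _; rewrite mulrC.
move=> Bphi BV; have zz := ler_wpM2r (ltW zK) zi.
rewrite -(ler_pM2l zK) (_ : _ * `|_| = `|z ^+ K.+1 * rk K.+1 - z ^+ K.+1 * rho K.+1 n|).
  2: by rewrite -mulrBr normrM gtr0_norm.
rewrite (_ : z ^+ K.+1 * eps = 2 * (z ^+ K.+1 * (eps / 2))); last by field.
move: Un zz Bphi BV; rewrite /U [z ^+ K.+2]exprS (mulrC (rk _)) (mulrC (eps / 2)) -mulrA !ler_norml.
move: (z * _) (z ^+ K.+1 * _) (z ^+ K.+1 * _) (z ^+ K.+1 * _).
move: (\sum_(_ <= _ < _) _) (\sum_(_ <= _ < _) _) (V z n) (Num.sqrt _) => *.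
by lra.
Unshelve. all: by end_near. Qed.
End coefficient_extraction.

(** * Occupation sums in terms of the counts R_n and R_{n,k} *)

Section digit_counts.
Context {R : realType}.
Implicit Types (z w : R).

Lemma occ_sum_prefix z w n : occ_sum z (rev_prefix w n) =
  \sum_(x <- undup (cf_prefix w n)) (1 - z ^+ Ncount n x w).
Proof.
rewrite (occ_sum_sub z _ (undup (cf_prefix w n))) ?undup_uniq//; last first.
  by move=> x; rewrite mem_rev mem_undup.
by apply: eq_bigr => x _; rewrite /rev_prefix count_rev.
Qed.

Lemma Rn_occ_sum w n : (Rn n w)%:R = occ_sum 0 (rev_prefix w n) :> R.
Proof.
rewrite occ_sum_prefix big_seq (eq_bigr (fun=> 1)) => [|x].
  by rewrite -big_seq big_const_seq count_predT iter_addr_0.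
rewrite mem_undup => xw; rewrite expr0n; have := xw.
by rewrite -has_pred1 has_count => /lt0n_neq0/negPf ->; rewrite subr0.
Qed.

Lemma Rn_gt0 w n : (0 < n)%N -> (0 < Rn n w)%N.
Proof.
case: n => // n _; rewrite /Rn lt0n size_eq0; apply/eqP => /undup_nil.
by rewrite /cf_prefix.
Qed.

(** A value occurring N times leaves remainder 0 if N <= K, and z^N <= z^(K+1) otherwise; there are
    R_n such values. *)
Lemma Rnk_genfun z w n K : 0 <= z <= 1 ->
  0 <= (Rn n w)%:R - occ_sum z (rev_prefix w n)
       - \sum_(1 <= k < K.+1) z ^+ k * (Rnk n k w)%:R
    <= z ^+ K.+1 * (Rn n w)%:R.
Proof.
move=> /andP[z0 z1]; set s := undup (cf_prefix w n).
pose rem x := z ^+ Ncount n x w - \sum_(1 <= k < K.+1) (Ncount n x w == k)%:R * z ^+ k.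
have remE : (Rn n w)%:R - occ_sum z (rev_prefix w n)
    - \sum_(1 <= k < K.+1) z ^+ k * (Rnk n k w)%:R = \sum_(x <- s) rem x.
  rewrite sumrB exchange_big/= occ_sum_prefix sumrB -/s big_const_seq count_predT.
  rewrite iter_addr_0 /Rn -/s subKr; congr (_ - _).
  apply: eq_bigr => k _; rewrite -mulr_suml mulrC; congr (_ * _).
  rewrite /Rnk size_filter -/s -sum1_count natr_sum big_mkcond/=.
  by apply: eq_bigr => x _; case: eqP.
have rem_bounds x : x \in s -> 0 <= rem x <= z ^+ K.+1.
  rewrite mem_undup -has_pred1 has_count -/(Ncount n x w) /rem => N0.
  have [NK|KN] := leqP (Ncount n x w) K.
    rewrite (bigD1_seq (Ncount n x w)) ?iota_uniq ?mem_index_iota ?N0 ?ltnS//=.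
    rewrite eqxx mul1r big1 ?addr0 ?subrr ?lexx ?exprn_ge0// => k /negPf kN.
    by rewrite eq_sym kN mul0r.
  rewrite big_nat_cond big1 ?subr0 ?exprn_ge0//=; last first.
    move=> k; rewrite andbT ltnS => /andP[_ kK].
    by rewrite gtn_eqF ?mul0r// (leq_ltn_trans kK).
  exact: ler_wiXn2l.
rewrite remE; apply/andP; split.
  by rewrite big_seq sumr_ge0// => x /rem_bounds /andP[].
rewrite /Rn -/s mulr_natr -iter_addr_0 -(count_predT s) -big_const_seq.
by rewrite big_seq [leRHS]big_seq; apply: ler_sum => x /rem_bounds /andP[].
Qed.
End digit_counts.

Theorem theorem1 (R : realType) :
  ({ae (@lebesgue_measure R), forall w : R, 0 < w < 1 ->
      ((fun n : nat => (Rn n w)%:R / Num.sqrt (n%:R : R)) @ \oo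
         --> Num.sqrt (pi / ln 2 : R))
      /\ (forall k : nat, (1 <= k)%N ->
          (fun n : nat => ((Rnk n k w)%:R / (Rn n w)%:R : R)) @ \oo
            --> (rk k : R))})
  /\ ((fun n : nat => \sum_(1 <= k < n) (rk k : R)) @ \oo --> (1 : R)).
Proof.
split; last first.
  have c1 : (fun n => 1 - central n) @ \oo --> (1 : R).
    rewrite -[X in _ --> X]subr0; apply: cvgB; first exact: cvg_cst.
    exact: central_cvg0.
  rewrite -(cvg_shiftS (fun n : nat => \sum_(1 <= k < n) (rk k : R))) /=.
  by under eq_fun do rewrite sum_rk.
have zi01 (i : nat) : 0 <= (i.+2%:R^-1 : R) < 1.
  by rewrite invr_ge0 ler0n/= invf_lt1 ?ltr0n// ltr1n.
(* Only countably many z are used, so one null set serves all of them. *)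
have ae_z := ae_foralln (fun i : nat => ae_occ_sum_limit (i.+2%:R^-1) (zi01 i)).
have ae_0 := @ae_occ_sum_limit R 0 ltac:(by rewrite lexx ltr01).
have fae := ae_filter_ringOfSetsType (@lebesgue_measure R).
apply: (@filterS2 _ _ fae _ _ _ _ ae_0 ae_z) => w W0 Wz w01.
have pl0 : 0 < pi / ln 2 :> R.
  by rewrite divr_gt0 ?pi_gt0//; have := @ln2_ge R; lra.
have R0 : (fun n : nat => (Rn n w)%:R / Num.sqrt (n%:R : R)) @ \oo
    --> Num.sqrt (pi / ln 2 : R).
  have := W0 w01; rewrite subr0 sqrtr1 mulr1.
  by under eq_fun do rewrite -Rn_occ_sum.
split=> //; apply: (coef_limit (fun z n => occ_sum z (rev_prefix w n) / (Rn n w)%:R)) => [i|i K].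
  set z : R := i.+2%:R^-1.
  have sq0 : Num.sqrt (pi / ln 2) != 0 :> R by rewrite gt_eqF ?sqrtr_gt0.
  have limE : Num.sqrt (pi / ln 2) * Num.sqrt (1 - z) * (Num.sqrt (pi / ln 2))^-1
    = Num.sqrt (1 - z) :> R by rewrite mulrAC divff// mul1r.
  have fE : (fun n => occ_sum z (rev_prefix w n) / (Rn n w)%:R) =
      (fun n => occ_sum z (rev_prefix w n) / Num.sqrt n%:R
                * ((Rn n w)%:R / Num.sqrt n%:R)^-1).
    (* At n = 0 both sides are 0, the inverse of 0 being 0. *)
    apply/funext => -[|n]; first by rewrite /Rn /= invr0 mulr0 sqrtr0 invr0 !mulr0 mul0r.
    have sn0 : Num.sqrt n.+1%:R != 0 :> R by rewrite gt_eqF// sqrtr_gt0 ltr0n.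
    by rewrite invf_div mulrA divfK.
  by rewrite /= fE -limE; apply: cvgM; [exact: Wz|exact: cvgV].
set z : R := i.+2%:R^-1; have /andP[z0 z1] := zi01 i.
near=> n.
have n0 : (0 < n)%N by near: n; exists 1%N.
have rn0 : 0 < (Rn n w)%:R :> R by rewrite ltr0n Rn_gt0.
have /andP[lo hi] := @Rnk_genfun R z w n K ltac:(by rewrite z0 ltW).
have -> : 1 - occ_sum z (rev_prefix w n) / (Rn n w)%:R
      - \sum_(1 <= k < K.+1) z ^+ k * ((Rnk n k w)%:R / (Rn n w)%:R) =
    ((Rn n w)%:R - occ_sum z (rev_prefix w n)
      - \sum_(1 <= k < K.+1) z ^+ k * (Rnk n k w)%:R) / (Rn n w)%:R.
  rewrite [RHS]mulrBl [in RHS]mulrBl divff ?lt0r_neq0//.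
  by congr (_ + - _); rewrite mulr_suml; apply: eq_bigr => k _; rewrite mulrA.
by rewrite divr_ge0 ?(ltW rn0)//= ler_pdivrMr.
Unshelve. all: by end_near. Qed.
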